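(* For every integer $N \geq 1$, there exist constants $c = c(N) > 0$ and $C = C(N) < \infty$ (depending only on $N$) such that $$c^p \, \|\nabla u\|_{L^p(\mathbb{R}^N)}^p \;\leq\; \left[ \frac{u(x)-u(y)}{|x-y|^{\frac{N}{p}+1}} \right]_{M^p(\mathbb{R}^N \times \mathbb{R}^N)}^p \;\leq\; C \, \|\nabla u\|_{L^p(\mathbb{R}^N)}^p$$ for all $u \in C^{\infty}_c(\mathbb{R}^N)$ and all $1 \leq p < \infty$.
   Context: $C^\infty_c(\mathbb{R}^N)$ is the space of (real-valued) smooth compactly supported functions on $\mathbb{R}^N$, and $\|\nabla u\|_{L^p(\mathbb{R}^N)}^p = \int_{\mathbb{R}^N} |\nabla u(x)|^p \, dx$ with $|\cdot|$ the Euclidean norm. For $1 \le p < \infty$, the Marcinkiewicz (weak $L^p$) quasi-norm of a measurable function $f$ on $\mathbb{R}^N \times \mathbb{R}^N$ is defined by $$[f]_{M^p(\mathbb{R}^N \times \mathbb{R}^N)}^p := \sup_{\lambda > 0} \lambda^p \, \mathcal{L}^{2N}\bigl(\{ (x,y) \in \mathbb{R}^N \times \mathbb{R}^N : |f(x,y)| \geq \lambda \}\bigr),$$ where $\mathcal{L}^{2N}$ is Lebesgue measure on $\mathbb{R}^N \times \mathbb{R}^N$. The quotient in the claim is regarded as a function of $(x,y)$ defined for $x \neq y$ (the diagonal has measure zero). *)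

(* Defs.v *)
From HB Require Import structures.
From mathcomp Require Import all_boot all_order all_algebra.
From mathcomp Require Import all_classical all_reals all_analysis.

Set Implicit Arguments.
Unset Strict Implicit.
Unset Printing Implicit Defensive.

Import Order.TTheory GRing.Theory Num.Theory.
Import numFieldNormedType.Exports.

Local Open Scope classical_set_scope.
Local Open Scope ring_scope.

(* The sigma-algebra of R^n is the one generated by the coordinate functions,
   as for n.-tuple in the library; it is the Borel sigma-algebra of R^n. *)
Section measurable_rV.
Context {d} {T : sigmaRingType d}.
Variable n : nat.

Let coors : 'I_n -> 'rV[T]_n -> T := fun i x => x ord0 i.

Let rV_set0 : g_sigma_preimage coors set0.
Proof. exact: sigma_algebra0. Qed.

Let rV_setC A : g_sigma_preimage coors A -> g_sigma_preimage coors (~` A).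
Proof. exact: sigma_algebraC. Qed.

Let rV_bigcup (F : _^nat) : (forall i, g_sigma_preimage coors (F i)) ->
  g_sigma_preimage coors (\bigcup_i (F i)).
Proof. exact: sigma_algebra_bigcup. Qed.

HB.instance Definition _ := @isMeasurable.Build (measure_tuple_display d)
  'rV[T]_n (g_sigma_preimage coors) rV_set0 rV_setC rV_bigcup.

End measurable_rV.

Lemma measurable_coord d (T : sigmaRingType d) n (i : 'I_n) :
  measurable_fun [set: 'rV[T]_n] (fun v : 'rV[T]_n => v ord0 i).
Proof.
move=> _ Y mY; rewrite setTI; apply: sub_sigma_algebra => /=.
rewrite -bigcup_seq/=; exists i => /=; first by rewrite mem_index_enum.
by exists Y => //; rewrite setTI.
Qed.

Lemma measurable_fun_coordP d1 d2 (T1 : measurableType d1)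
    (T2 : measurableType d2) n (f : T1 -> 'rV[T2]_n) :
  measurable_fun [set: T1] f <->
  forall i, measurable_fun [set: T1] (fun x => f x ord0 i).
Proof.
split=> [mf i|mf].
  exact: (measurableT_comp (measurable_coord i) mf).
have : g_sigma_preimage (fun i x => f x ord0 i) `<=` measurable.
  apply: smallest_sub; first exact: sigma_algebra_measurable.
  case: n => [|n] in f mf *; first by rewrite big_ord0.
  rewrite -bigcup_mkord_ord; apply: bigcup_sub => i Ii.
  by move=> A [B mB <-]; exact: mf.
rewrite (g_sigma_preimage_comp (fun i (v : 'rV[T2]_n) => v ord0 i) f) => + _ A mA.
by apply; exists A.
Qed.

Section rV_cons.
Context {T : Type} {n : nat}.

Definition rV_cons (z : T * 'rV[T]_n) : 'rV[T]_n.+1 :=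
  \row_(i < n.+1) oapp (z.2 ord0) z.1 (unlift ord0 i).

Lemma rV_cons0 z : rV_cons z ord0 ord0 = z.1.
Proof. by rewrite mxE unlift_none. Qed.

Lemma rV_consS z i : rV_cons z ord0 (lift ord0 i) = z.2 ord0 i.
Proof. by rewrite mxE liftK. Qed.

Lemma rV_cons_eta (v : 'rV[T]_n.+1) :
  rV_cons (v ord0 ord0, \row_i v ord0 (lift ord0 i)) = v.
Proof.
apply/rowP => i; case: (unliftP ord0 i) => [j ->|->].
  by rewrite rV_consS mxE.
by rewrite rV_cons0.
Qed.

End rV_cons.

Lemma measurable_rV_cons d (T : measurableType d) n :
  measurable_fun [set: T * 'rV[T]_n] (@rV_cons T n).
Proof.
apply/measurable_fun_coordP => i; case: (unliftP ord0 i) => [j ->|->].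
  rewrite (_ : (fun _ => _) = (fun v : 'rV[T]_n => v ord0 j) \o snd).
    by apply: measurableT_comp => //; exact: measurable_coord.
  by apply/funext => z; rewrite rV_consS.
by rewrite (_ : (fun _ => _) = fst)//; apply/funext => z; rewrite rV_cons0.
Qed.

Lemma sigma_finite_prod d1 d2 (T1 : measurableType d1) (T2 : measurableType d2)
    (R : realType) (m1 : {sigma_finite_measure set T1 -> \bar R})
    (m2 : {sigma_finite_measure set T2 -> \bar R}) :
  sigma_finite [set: T1 * T2] (m1 \x m2)%E.
Proof.
have /sigma_finiteP[F [TF ndF Foo]] := sigma_finiteT m1.
have /sigma_finiteP[G [TG ndG Goo]] := sigma_finiteT m2.
exists (fun n => F n `*` G n).
  rewrite -setXTT TF TG; apply/seteqP; split => -[x y] /=.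
    move=> [[n _ Fnx] [k _ Gky]]; exists (maxn n k) => //; split.
    - by move: x Fnx; exact/subsetPset/ndF/leq_maxl.
    - by move: y Gky; exact/subsetPset/ndG/leq_maxr.
  by move=> [n _ []/= ? ?]; split; exists n.
move=> k; have [? ?] := Foo k; have [? ?] := Goo k.
split; first exact: measurableX.
by rewrite product_measure1E// lte_mul_pinfty// ge0_fin_numE.
Qed.

Section lebesgue_rV.
Local Open Scope ereal_scope.
Context {R : realType}.

Section succ.
Context {n : nat} (m : {sigma_finite_measure set 'rV[R]_n -> \bar R}).

Definition lebesgue_rVS : set 'rV[R]_n.+1 -> \bar R :=
  pushforward (@lebesgue_measure R \x m) (@rV_cons R n).

Let mcons := @measurable_rV_cons _ R n.

Let lebesgue_rVS0 : lebesgue_rVS set0 = 0.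
Proof. by rewrite /lebesgue_rVS /pushforward preimage_set0 measure0. Qed.

Let lebesgue_rVS_ge0 A : 0 <= lebesgue_rVS A.
Proof. exact: measure_ge0. Qed.

Let lebesgue_rVS_sigma_additive : semi_sigma_additive lebesgue_rVS.
Proof. exact: (@measure_semi_sigma_additive _ _ _ (pushforward _ _)). Qed.

HB.instance Definition _ := isMeasure.Build _ _ _ lebesgue_rVS
  lebesgue_rVS0 lebesgue_rVS_ge0 lebesgue_rVS_sigma_additive.

Let lebesgue_rVS_sigma_finite : sigma_finite setT lebesgue_rVS.
Proof.
pose g (v : 'rV[R]_n.+1) := (v ord0 ord0, \row_i v ord0 (lift ord0 i)).
have mg : measurable_fun setT g.
  apply/measurable_fun_pair; first exact: measurable_coord.
  apply/measurable_fun_coordP => i.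
  rewrite (_ : (fun _ => _) = fun v : 'rV[R]_n.+1 => v ord0 (lift ord0 i)).
    exact: measurable_coord.
  by apply/funext => v; rewrite mxE.
have gK z : g (rV_cons z) = z.
  case: z => x v; rewrite /g rV_cons0; congr pair.
  by apply/rowP => i; rewrite mxE rV_consS.
have [F FT Foo] : sigma_finite setT (@lebesgue_measure R \x m).
  exact: sigma_finite_prod.
exists (fun k => g @^-1` F k).
  by rewrite -preimage_bigcup -FT preimage_setT.
move=> k; have [mF Fk] := Foo k; split.
  by rewrite -[X in measurable X]setTI; exact: mg.
rewrite /lebesgue_rVS /pushforward -comp_preimage.
by rewrite (_ : g \o _ = id)//; apply/funext => z /=; rewrite gK.
Qed.

HB.instance Definition _ := Measure_isSigmaFinite.Build _ _ _ lebesgue_rVS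
  lebesgue_rVS_sigma_finite.

End succ.

(* L^n, defined by L^0 = Dirac mass at the point and L^(n+1) = L^1 \x L^n
   transported along R * R^n ~ R^(n+1); see lebesgue_rV_box for boxes. *)
Fixpoint lebesgue_rV n : {sigma_finite_measure set 'rV[R]_n -> \bar R} :=
  if n is k.+1 then lebesgue_rVS (lebesgue_rV k) else \d_(0%R : 'rV[R]_0).

Let measurable_box n (A : 'I_n -> set R) : (forall i, measurable (A i)) ->
  measurable [set v : 'rV[R]_n | forall i, A i (v ord0 i)].
Proof.
move=> mA; rewrite (_ : [set v | _] = \bigcap_(i in [set: 'I_n])
    ((fun v : 'rV[R]_n => v ord0 i) @^-1` A i)); last first.
  by apply/seteqP; split => v /= vA i; [move=> _|]; exact: vA.
apply: fin_bigcap_measurable => [|i _]; first exact: finite_finset.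
by rewrite -[X in measurable X]setTI; exact: measurable_coord.
Qed.

Lemma lebesgue_rV_box n (A : 'I_n -> set R) : (forall i, measurable (A i)) ->
  lebesgue_rV n [set v | forall i, A i (v ord0 i)] =
  \prod_(i < n) lebesgue_measure (A i).
Proof.
elim: n A => [|n IH] A mA.
  rewrite big_ord0 /= diracE mem_set//.
  by case.
rewrite big_ord_recl -IH; last by move=> i; exact: mA.
rewrite [LHS]/= /lebesgue_rVS /pushforward.
rewrite -product_measure1E; [|exact: mA|exact: (measurable_box (fun i => mA (lift ord0 i)))].
congr (product_measure1 _ _ _); apply/seteqP; split => [z/= zA|z/= [z1 z2] i].
  split; first by have := zA ord0; rewrite rV_cons0.
  by move=> i; have := zA (lift ord0 i); rewrite rV_consS.
by case: (unliftP ord0 i) => [j ->|->]; rewrite ?rV_consS ?rV_cons0.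
Qed.

End lebesgue_rV.

(* Euclidean norm; the library's `|x| on 'rV[R]_n is the sup norm. *)
Definition enorm (R : realType) (n : nat) (x : 'rV[R]_n) : R :=
  Num.sqrt (\sum_(i < n) x ord0 i ^+ 2).

Section smooth.
Context {R : realType} {n : nat}.
Implicit Types (f u : 'rV[R]_n -> R).

Definition basis_vec (i : 'I_n) : 'rV[R]_n := delta_mx ord0 i.

Definition partial (i : 'I_n) f : 'rV[R]_n -> R :=
  fun x => 'D_(basis_vec i) f x.

Definition iter_partial (s : seq 'I_n) f : 'rV[R]_n -> R := foldr partial f s.

(* 'D_v f x is a total function (a limit with a default value), so the
   existence of each partial derivative has to be required. *)
Definition smooth f := forall s : seq 'I_n,
  continuous (iter_partial s f) /\
  forall i x, derivable (iter_partial s f) x (basis_vec i).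

Definition compactly_supported f := compact (closure [set x | f x != 0]).

Definition gradient f (x : 'rV[R]_n) : 'rV[R]_n := \row_(i < n) partial i f x.

Definition gradient_Lp_pow (p : R) f : \bar R :=
  (\int[lebesgue_rV n]_x (enorm (gradient f x) `^ p)%:E)%E.

(* At x = y the value is 0 / 0 = 0 by the library's conventions (for p > 0), so
   that the diagonal belongs to no superlevel set with positive level. *)
Definition diff_quotient (p : R) f (z : 'rV[R]_n * 'rV[R]_n) : R :=
  (f z.1 - f z.2) / enorm (z.1 - z.2) `^ (n%:R / p + 1).

End smooth.

Definition marcinkiewicz_pow d (T : measurableType d) (R : realType)
    (mu : set T -> \bar R) (p : R) (f : T -> R) : \bar R :=
  ereal_sup [set ((l `^ p)%:E * mu [set z | (l <= `|f z|)%R])%E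
            | l in [set l : R | 0 < l]].

(* Main.v *)
Require Import Defs.
From HB Require Import structures.
From mathcomp Require Import all_boot all_order all_algebra.
From mathcomp Require Import all_classical all_reals all_analysis.
From mathcomp Require Import measurable_realfun ring lra.
Import Order.TTheory GRing.Theory Num.Theory.
Import numFieldNormedType.Exports.
Local Open Scope classical_set_scope.
Local Open Scope ring_scope.

(* Upper bound.  Writing y = x + t e_v with e_v = (1, v), v in R^(N-1), turns dy
   into |t|^(N-1) dt dv.  On each line of direction e_v the superlevel set is
   the set of pairs (s, s + t) with
     |g (s + t) - g s| >= mu |t|^(N/p + 1),    mu = lambda |e_v|^(N/p + 1),
   and Jensen's inequality gives mu^p |I|^(N+1) <= \int_I |g'|^p on the interval
   I joining s to s + t.  By Vitali's covering lemma these pairs are covered by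
   dilates of disjoint such intervals, so their |t|^(N-1) dt ds measure is at
   most C mu^(-p) \int |g'|^p.  Integrating over the lines and using
   |g'| <= |e_v| |grad u| leaves the factor \int |e_v|^(-N) dv, which is finite.
   No p-th power of a constant is lost, since the path from x to y is straight.

   Lower bound.  For fixed x with gradient g <> 0 and large lambda, the slice
   {y : |u x - u y| >= lambda |x - y|^(N/p + 1)} contains a cube centered at
   x + a g / |g| whose volume is c (|g| / (6 lambda))^p; conclude by Fatou's
   lemma as lambda tends to infinity. *)

(** * Integration on row vectors *)

Section lebesgue_affine.
Context {R : realType}.
Local Notation mu := (@lebesgue_measure R).

(** Lebesgue measure is determined by its values on half-open intervals, and there it agrees with
    [|t|] times its own image under [x |-> a + t x]. *)
Lemma integral_affine (a t : R) (f : R -> \bar R) : t != 0 ->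
  measurable_fun [set: R] f -> (forall x, 0 <= f x)%E ->
  (\int[mu]_x f x = `|t|%:E * \int[mu]_x f (a + t * x)%R)%E.
Proof.
move=> t0 mf f0.
pose phi : measurableTypeR R -> measurableTypeR R := fun x => (a + t * x)%R.
have mphi : measurable_fun [set: measurableTypeR R] phi.
  by apply: measurable_funD => //; apply: measurable_funM.
have [nu nuE] : exists nu : {measure set (measurableTypeR R) -> \bar R},
    (nu : set _ -> _) = pushforward mu phi.
  by unshelve (eexists; reflexivity); exact: mphi.
transitivity (\int[mscale (NngNum (normr_ge0 t)) nu]_x f x)%E.
  apply: eq_measure_integral => A mA _.
  apply: lebesgue_measure_unique => // X [[x y] _ <-] /=.
  rewrite /mscale /= nuE /pushforward lebesgue_measure_itv/= lte_fin.
  have [t_gt0|t_lt0|/eqP] := ltgtP 0 t; last by rewrite eq_sym (negbTE t0).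
  - rewrite (_ : _ @^-1` _ = [set` `](x - a) / t, (y - a) / t]]); last first.
      apply/seteqP; split => z /=; rewrite !in_itv/= ltr_pdivrMr// ler_pdivlMr//
        ltrBlDl lerBrDl (mulrC z) //.
    rewrite lebesgue_measure_itv/= lte_fin ltr_pM2r ?invr_gt0// ltrD2r.
    case: ifPn => xy; last by rewrite mule0.
    rewrite -!EFinD -EFinM gtr0_norm//; congr EFin; field; exact: lt0r_neq0.
  (* A decreasing map exchanges the endpoints, so the preimage of a left-open interval is
     right-open; its length is the same. *)
  - rewrite (_ : _ @^-1` _ = [set` `[(y - a) / t, (x - a) / t[]); last first.
      apply/seteqP; split => z /=; rewrite !in_itv/= ltr_ndivlMr// ler_ndivrMr//
        ltrBlDl lerBrDl (mulrC z) andbC //.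
    rewrite lebesgue_measure_itv/= lte_fin ltr_nM2r ?invr_lt0// ltrD2r.
    case: ifPn => xy; last by rewrite mule0.
    rewrite -!EFinD -EFinM ltr0_norm//; congr EFin; field; exact: ltr0_neq0.
by rewrite ge0_integral_mscale//= nuE ge0_integral_pushforward.
Qed.

End lebesgue_affine.

Section rV_measurability.
Context {R : realType}.

Lemma measurable_rV_add d (T : measurableType d) n (f g : T -> 'rV[R]_n) :
  measurable_fun setT f -> measurable_fun setT g ->
  measurable_fun setT (fun x => f x + g x).
Proof.
move=> /measurable_fun_coordP mf /measurable_fun_coordP mg.
apply/measurable_fun_coordP => i; under eq_fun do rewrite mxE.
by apply: measurable_funD.
Qed.

Lemma measurable_rV_scale d (T : measurableType d) n (c : T -> R) (g : T -> 'rV[R]_n) :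
  measurable_fun setT c -> measurable_fun setT g ->
  measurable_fun setT (fun x => c x *: g x).
Proof.
move=> mc /measurable_fun_coordP mg.
apply/measurable_fun_coordP => i; under eq_fun do rewrite mxE.
by apply: measurable_funM.
Qed.

Lemma measurable_rV_consT d (T : measurableType d) n (f : T -> R) (g : T -> 'rV[R]_n) :
  measurable_fun setT f -> measurable_fun setT g ->
  measurable_fun setT (fun x => rV_cons (f x, g x)).
Proof.
move=> mf mg.
apply: (measurableT_comp (@measurable_rV_cons _ R n)).
exact: measurable_fun_pair.
Qed.

Lemma measurable_enorm n : measurable_fun setT (@enorm R n).
Proof.
apply: (measurableT_comp (continuous_measurable_fun (@sqrt_continuous R))).
by apply: measurable_sum => i; apply: measurable_funX; exact: measurable_coord.
Qed.

End rV_measurability.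

Section integral_rV.
Context {R : realType}.
Local Notation mu := (@lebesgue_measure R).
Local Open Scope ereal_scope.

(** By construction [lebesgue_rV n.+1] is the image of a product measure under [rV_cons], so this is
    Tonelli's theorem. *)
Lemma integral_rVS n (f : 'rV[R]_n.+1 -> \bar R) :
  measurable_fun setT f -> (forall x, 0 <= f x) ->
  \int[lebesgue_rV n.+1]_x f x =
  \int[mu]_s \int[lebesgue_rV n]_z f (rV_cons (s, z)).
Proof.
move=> mf f0.
have mcons : measurable_fun setT (@rV_cons R n : measurableTypeR R * 'rV[R]_n -> 'rV[R]_n.+1).
  exact: measurable_rV_cons.
rewrite [LHS](ge0_integral_pushforward mcons (mu \x lebesgue_rV n))//.
by rewrite preimage_setT fubini_tonelli1//=; exact: measurableT_comp.
Qed.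

Lemma rV_consD n (a b : R * 'rV[R]_n) :
  rV_cons (a.1 + b.1, a.2 + b.2)%R = (rV_cons a + rV_cons b)%R.
Proof.
by apply/rowP => i; rewrite !mxE; case: unliftP => [j|] _ //=; rewrite mxE.
Qed.

Lemma rV_consZ n (t : R) (b : R * 'rV[R]_n) :
  rV_cons (t * b.1, t *: b.2)%R = (t *: rV_cons b)%R.
Proof.
by apply/rowP => i; rewrite !mxE; case: unliftP => [j|] _ //=; rewrite mxE.
Qed.

(** Induction on the dimension: the last [n] coordinates give [|t| ^+ n], and the first one a
    further [|t|] by [integral_affine]. *)
Lemma integral_rV_affine n (a : 'rV[R]_n) (t : R) (f : 'rV[R]_n -> \bar R) :
  t != 0%R -> measurable_fun setT f -> (forall x, 0 <= f x) ->
  \int[lebesgue_rV n]_x f x =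
  (`|t| ^+ n)%:E * \int[lebesgue_rV n]_x f (a + t *: x)%R.
Proof.
move=> t0; elim: n a f => [|n IH] a f mf f0.
  rewrite expr0 mul1e; apply: eq_integral => x _; congr f.
  by apply/rowP; case.
have mat : measurable_fun setT (fun x : 'rV[R]_n.+1 => f (a + t *: x)%R).
  apply: measurableT_comp => //.
  by apply: measurable_rV_add => //; exact: measurable_rV_scale.
rewrite integral_rVS// [in RHS]integral_rVS//.
pose a' : 'rV[R]_n := \row_i a ord0 (lift ord0 i).
have ma' : measurable_fun setT (fun z : measurableTypeR R * 'rV[R]_n =>
    f (rV_cons (z.1, (a' + t *: z.2)%R))).
  apply: measurableT_comp => //; apply: measurable_rV_consT => //.
  by apply: measurable_rV_add => //; exact: measurable_rV_scale.
have mF := measurable_fun_fubini_tonelli_F (m2 := lebesgue_rV n) _ ma' (fun=> f0 _).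
under eq_integral => s _.
  rewrite (IH a'); [|by apply: measurableT_comp => //; exact: measurable_rV_consT|by []].
  over.
rewrite ge0_integralZl//; last by move=> s _; apply: integral_ge0.
rewrite [X in _ * X = _](integral_affine (a ord0 ord0) t)//; last first.
  by move=> s; apply: integral_ge0.
rewrite muleA -EFinM -exprSr; congr (_ * _).
apply: eq_integral => s _; apply: eq_integral => z _; congr f.
by rewrite -[a in RHS]rV_cons_eta -rV_consZ -rV_consD.
Qed.

Lemma integral_rV_translate n (a : 'rV[R]_n) (f : 'rV[R]_n -> \bar R) :
  measurable_fun setT f -> (forall x, 0 <= f x) ->
  \int[lebesgue_rV n]_x f x = \int[lebesgue_rV n]_x f (a + x)%R.
Proof.
move=> mf f0; rewrite (integral_rV_affine _ a 1)// ?oner_neq0//.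
rewrite normr1 expr1n mul1e; apply: eq_integral => x _.
by rewrite scale1r.
Qed.

(* Foliation of R^(n+1) by the lines of direction (1, v). *)
Lemma integral_rV_shear n (v : 'rV[R]_n) (f : 'rV[R]_n.+1 -> \bar R) :
  measurable_fun setT f -> (forall x, 0 <= f x) ->
  \int[lebesgue_rV n.+1]_x f x =
  \int[lebesgue_rV n]_z \int[mu]_s f (rV_cons (0%R, z) + s *: rV_cons (1%R, v))%R.
Proof.
move=> mf f0; rewrite integral_rVS//.
have shearE (s : R) (z : 'rV[R]_n) :
    (rV_cons (0, z) + s *: rV_cons (1, v))%R = rV_cons (s, s *: v + z)%R.
  by rewrite -rV_consZ -rV_consD /= mulr1 add0r [(_ + z)%R]addrC.
under eq_integral => s _.
  rewrite (integral_rV_translate _ (s *: v)%R)//; last first.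
    by apply: measurableT_comp => //; exact: measurable_rV_consT.
  over.
rewrite (fubini_tonelli (fun x : measurableTypeR R * 'rV[R]_n =>
  f (rV_cons (x.1, (x.1 *: v + x.2)%R))))//.
  by apply: eq_integral => z _; apply: eq_integral => s _; rewrite shearE.
apply: measurableT_comp => //; apply: measurable_rV_consT => //.
by apply: measurable_rV_add => //; exact: measurable_rV_scale.
Qed.

Lemma measurable_polar n (F : 'rV[R]_n.+1 * 'rV[R]_n.+1 -> \bar R) :
  measurable_fun setT F ->
  measurable_fun setT (fun z : ('rV[R]_n.+1 * 'rV[R]_n) * measurableTypeR R =>
    (`|z.2| ^+ n)%:E * F (z.1.1, (z.1.1 + z.2 *: rV_cons (1%R, z.1.2))%R)).
Proof.
move=> mF; apply: emeasurable_funM.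
  apply/measurable_EFinP; apply: measurable_funX.
  exact: (measurableT_comp (@normr_measurable R setT) measurable_snd).
apply: (measurableT_comp mF).
pose T := ((('rV[R]_n.+1 * 'rV[R]_n) * measurableTypeR R)%type).
have m11 : measurable_fun setT (fun z : T => z.1.1).
  exact: (measurableT_comp measurable_fst measurable_fst).
have m12 : measurable_fun setT (fun z : T => z.1.2).
  exact: (measurableT_comp measurable_snd measurable_fst).
apply/measurable_fun_pair; first exact: m11.
apply: measurable_rV_add; first exact: m11.
apply: measurable_rV_scale; first exact: measurable_snd.
exact: measurable_rV_consT.
Qed.

Lemma measurable_integral_polar n (F : 'rV[R]_n.+1 * 'rV[R]_n.+1 -> \bar R) :
  measurable_fun setT F -> (forall x, 0 <= F x) ->
  measurable_fun setT (fun z : 'rV[R]_n.+1 * 'rV[R]_n => \int[mu]_t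
    ((`|t| ^+ n)%:E * F (z.1, (z.1 + t *: rV_cons (1%R, z.2))%R))).
Proof.
move=> mF F0.
apply: (measurable_fun_fubini_tonelli_F (m2 := mu) _ (measurable_polar _ _ mF)).
by move=> z; rewrite mule_ge0// lee_fin exprn_ge0.
Qed.

(** After translation by [x], write [y - x = (t, w)] and substitute [w = t v] in the last [n]
    coordinates; the Jacobian is [|t| ^+ n]. Directions are thus normalized by their first
    coordinate instead of their length, which avoids a measure on the sphere. *)
Lemma integral_rV_polar n (F : 'rV[R]_n.+1 * 'rV[R]_n.+1 -> \bar R) :
  measurable_fun setT F -> (forall x, 0 <= F x) ->
  \int[lebesgue_rV n.+1]_x \int[lebesgue_rV n.+1]_y F (x, y) =
  \int[lebesgue_rV n]_v \int[lebesgue_rV n.+1]_x \int[mu]_t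
     ((`|t| ^+ n)%:E * F (x, (x + t *: rV_cons (1, v))%R)).
Proof.
move=> mF F0.
pose G (x : 'rV[R]_n.+1) (z : measurableTypeR R * 'rV[R]_n) : \bar R :=
  (`|z.1| ^+ n)%:E * F (x, (x + z.1 *: rV_cons (1, z.2))%R).
have G0 x z : 0 <= G x z by rewrite mule_ge0// lee_fin exprn_ge0.
have mG x : measurable_fun setT (G x).
  have mphi : measurable_fun setT
      (fun z : measurableTypeR R * 'rV[R]_n => ((x, z.2), z.1)).
    by apply/measurable_fun_pair => //=; exact/measurable_fun_pair.
  exact: (measurableT_comp (measurable_polar _ _ mF) mphi).
transitivity (\int[lebesgue_rV n.+1]_x \int[lebesgue_rV n]_v \int[mu]_t G x (t, v)); last first.
  rewrite (fubini_tonelli (fun z : 'rV[R]_n.+1 * 'rV[R]_n => \int[mu]_t G z.1 (t, z.2)))//.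
    exact: measurable_integral_polar.
  by move=> z; apply: integral_ge0.
apply: eq_integral => x _.
have mFx : measurable_fun setT (fun y => F (x, y)) by apply: measurableT_comp.
have mFt : measurable_fun setT (fun y => F (x, (x + y)%R)).
  by apply: (measurableT_comp mFx); apply: measurable_rV_add.
rewrite (integral_rV_translate _ x)// integral_rVS//.
rewrite -(fubini_tonelli (G x))//.
(* The substitution [w = t v] degenerates at [t = 0], so the inner integrals are compared only off
   this null set. *)
apply: ge0_ae_eq_integral => //.
- apply: (measurable_fun_fubini_tonelli_F (m2 := lebesgue_rV n)
    (fun z => F (x, (x + rV_cons z)%R))) => //.
  exact: (measurableT_comp mFt (@measurable_rV_cons _ R n)).
- exact: (measurable_fun_fubini_tonelli_F (m2 := lebesgue_rV n) (G x)).
- by move=> t _; exact: integral_ge0.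
- by move=> t _; exact: integral_ge0.
exists [set 0%R]; split => //; first exact: lebesgue_measure_set1.
move=> t /=; apply: contra_notP => /eqP t0 _.
have mcons z : measurable_fun setT (fun y : 'rV[R]_n => F (x, (x + rV_cons (t, z + t *: y))%R)).
  apply: (measurableT_comp mFt); apply: measurable_rV_consT => //.
  by apply: measurable_rV_add => //; exact: measurable_rV_scale.
rewrite (integral_rV_affine _ 0%R t)//; last first.
  by apply: (measurableT_comp mFt); exact: measurable_rV_consT.
rewrite -ge0_integralZl//.
apply: eq_integral => v _; rewrite /G /=; congr (_ * F (_, (_ + _)%R)).
by rewrite add0r -rV_consZ /= mulr1.
Qed.

End integral_rV.

(** * Continuity and differentiability on row vectors *)

Section rV_topology_measurability.
Context {R : realType} {n : nat}.

Lemma measurable_rV_box (A : 'I_n -> set R) : (forall i, measurable (A i)) ->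
  measurable [set v : 'rV[R]_n | forall i, A i (v ord0 i)].
Proof.
move=> mA; rewrite (_ : [set v | _] = \bigcap_(i in [set: 'I_n])
    ((fun v : 'rV[R]_n => v ord0 i) @^-1` A i)); last first.
  by apply/seteqP; split => v /= vA i; [move=> _|]; exact: vA.
apply: fin_bigcap_measurable => [|i _]; first exact: finite_finset.
by rewrite -[X in measurable X]setTI; exact: measurable_coord.
Qed.

(** An open set is the union of the countably many cubes with rational center and radius
    [1 / (m + 1)] that it contains, and cubes are measurable for the coordinate sigma-algebra. *)
Lemma open_measurable_rV (U : set 'rV[R]_n) : open U -> measurable U.
Proof.
move=> oU.
pose box (k : 'rV[rat]_n * nat) : set 'rV[R]_n :=
  [set v | forall i, ball (ratr (k.1 ord0 i) : R) k.2.+1%:R^-1 (v ord0 i)].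
rewrite (_ : U = \bigcup_k (if `[< box k `<=` U >] then box k else set0)).
  apply: countable_bigcupT_measurable; first exact: countableP.
  move=> k; case: ifPn => // _.
  apply: (measurable_rV_box (fun i => ball (ratr (k.1 ord0 i) : R) k.2.+1%:R^-1)).
  by move=> i; exact: measurable_ball.
apply/seteqP; split => [x Ux|x [k _]]; last by case: asboolP => // kU /kU.
have /nbhs_ballP[e /= e0 xeU] : nbhs x U by apply: open_nbhs_nbhs; split.
(* The rational center is within [1 / (m + 1) < e / 2] of [x], so the cube of that radius contains
   [x] and stays within [e] of it. *)
pose m := Num.truncn (2 / e).
have me : m.+1%:R^-1 < e / 2.
  rewrite -[ltRHS]invrK ltf_pV2 ?posrE// ?invr_gt0 ?divr_gt0// invf_div.
  by rewrite truncnS_gt.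
have /choice[q qx] (i : 'I_n) : exists r : rat, ball (x ord0 i) m.+1%:R^-1 (ratr r : R).
  have /rat_in_itvoo[r] : x ord0 i - m.+1%:R^-1 < x ord0 i + m.+1%:R^-1.
    by rewrite ltrBlDr -addrA ltrDl addr_gt0 ?invr_gt0.
  rewrite in_itv/= => /andP[r1 r2]; exists r.
  by rewrite /ball/= ltr_distlC r1.
exists (\row_i q i, m) => //; case: asboolP => [_ i|]; rewrite /= ?mxE.
  by apply: ball_sym; exact: qx.
case=> y ky; apply: xeU; split => // i j; rewrite (ord1 i).
rewrite (splitr e); apply: (@ball_triangle _ _ (ratr (q j) : R)).
  by apply: le_ball (qx j); exact: ltW.
have := ky j; rewrite /= mxE; apply: le_ball; exact: ltW.
Qed.

Lemma continuous_measurable_rV (f : 'rV[R]_n -> R) :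
  continuous f -> measurable_fun setT f.
Proof.
move=> /continuousP cf; apply: (measurability _ (RGenOInfty.measurableE R)) => //.
move=> /= _ [_ [a ->] <-]; rewrite setTI; apply: open_measurable_rV.
exact/cf/interval_open.
Qed.

End rV_topology_measurability.

(** * Derivatives along lines and the chain rule for C^1 functions *)

Section directional.
Context {R : realType} {V : normedModType R}.
Implicit Types (f : V -> R) (x v : V).

Lemma is_derive_line f x v (s : R) : derivable f (x + s *: v) v ->
  is_derive s 1 (fun t : R => f (x + t *: v)) ('D_v f (x + s *: v)).
Proof.
move=> df.
have E : (fun h : R =>
      h^-1 *: (((fun t : R => f (x + t *: v)) \o shift s) (h *: 1) - f (x + s *: v)))
  = (fun h : R => h^-1 *: ((f \o shift (x + s *: v)) (h *: v) - f (x + s *: v))).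
  apply/funext => h /=; congr (_ *: (f _ - _)).
  by rewrite [h *: 1]mulr1 scalerDl addrCA.
apply: DeriveDef; first by rewrite /derivable E.
by rewrite /derive E.
Qed.

Lemma mvt_line f x v (t : R) : (forall y, derivable f y v) ->
  exists2 s, `|s| <= `|t| & f (x + t *: v) - f x = t * 'D_v f (x + s *: v).
Proof.
move=> df.
pose g (s : R) := f (x + s *: v).
have dg (s : R) : is_derive s (1 : R) g ('D_v f (x + s *: v)) by exact: is_derive_line.
have cg : continuous g.
  move=> s; apply: differentiable_continuous; apply/derivable1_diffP.
  exact: ex_derive.
have g0 : g 0 = f x by rewrite /g scale0r addr0.
have [t0|t0] := leP 0 t.
  have [|s] := @MVT_segment _ g (fun s => 'D_v f (x + s *: v)) 0 t t0 (fun s _ => dg s).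
    exact: continuous_subspaceT.
  rewrite in_itv/= => /andP[s0 st] E; exists s; first by rewrite !ger0_norm.
  by rewrite -g0 -/(g t) E subr0 mulrC.
have [|s] := @MVT_segment _ g (fun s => 'D_v f (x + s *: v)) t 0 (ltW t0) (fun s _ => dg s).
  exact: continuous_subspaceT.
rewrite in_itv/= => /andP[s0 st] E; exists s; first by rewrite !ler0_norm ?lerN2// ltW.
by rewrite -g0 -/(g t) -opprB E sub0r mulrN opprK mulrC.
Qed.

End directional.

Section C1.
Context {R : realType} {n : nat}.
Variable f : 'rV[R]_n -> R.
Hypothesis df : forall i x, derivable f x (basis_vec i).
Hypothesis cf : forall i, continuous (partial i f).

(** The increment is telescoped by changing one coordinate at a time. Each step is a mean value
    along a basis vector, where the partial derivative is close to its value at [x]. *)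
Lemma C1_differentiable (x : 'rV[R]_n) (e : R) : 0 < e ->
  exists2 d : R, 0 < d & forall h : 'rV[R]_n, `|h| < d ->
    `|f (x + h) - f x - \sum_(i < n) h ord0 i * partial i f x| <= e * `|h|.
Proof.
move=> e0.
(* The [n] coordinate errors must add up to at most [e]; dividing by [n + 1] also covers [n = 0]. *)
have e1 : 0 < e / n.+1%:R by rewrite divr_gt0.
have : \forall y \near x, forall i : 'I_n, `|partial i f x - partial i f y| < e / n.+1%:R.
  apply: (@filter_forall _ _
    (fun i y => `|partial i f x - partial i f y| < e / n.+1%:R) (nbhs x) _) => i.
  by have /cvgrPdist_lt := cf i x; apply.
move=> /nbhs_ballP[d /= d0 H]; exists d => // h hd.
(* [P j] is [x] with only the first [j] coordinates of [h] added. The segments joining successive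
   points stay in the sup-norm ball of radius [d]. *)
pose P (j : nat) : 'rV[R]_n := x + \row_i (if (i < j)%N then h ord0 i else 0).
have P0 : P 0%N = x by rewrite /P (_ : \row__ _ = 0) ?addr0//; apply/rowP => i; rewrite !mxE.
have Pn : P n = x + h.
  by congr (_ + _); apply/rowP => i; rewrite !mxE ltn_ord.
have PS (j : 'I_n) : P j.+1 = P j + h ord0 j *: basis_vec j.
  rewrite /P -addrA; congr (_ + _); apply/rowP => i; rewrite !mxE eqxx/= ltnS.
  have [->|ij] := eqVneq i j; first by rewrite leqnn ltnn mulr1 add0r.
  rewrite mulr0 addr0 leq_eqVlt.
  by rewrite (_ : (i == j :> nat) = false) //; exact: negbTE.
have hi i : `|h ord0 i| <= `|h|.
  by rewrite [leRHS]mx_normrE; apply: (le_bigmax _ (fun k => `|h k.1 k.2|) (ord0, i)).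
have step (j : 'I_n) : `|f (P j.+1) - f (P j) - h ord0 j * partial j f x| <= `|h| * (e / n.+1%:R).
  rewrite PS; have [s st ->] := mvt_line f (P j) (basis_vec j) (h ord0 j) (df j).
  rewrite -mulrBr normrM; apply: ler_pM => //.
  rewrite distrC; apply/ltW; apply: H; split => // a b; rewrite (ord1 a).
  rewrite /ball/= !mxE eqxx/= -addrA opprD addrA subrr sub0r normrN.
  have [->|bj] := eqVneq b j.
    by rewrite ltnn add0r mulr1 (le_lt_trans st)// (le_lt_trans (hi _)).
  rewrite mulr0 addr0; case: ifPn => _; first by rewrite (le_lt_trans (hi _)).
  by rewrite normr0.
rewrite -Pn -P0 -(telescope_sumr (fun j => f (P j)))// big_mkord P0 -sumrB.
apply: (le_trans (ler_norm_sum _ _ _)).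
apply: (@le_trans _ _ (\sum_(i < n) (`|h| * (e / n.+1%:R)))).
  by apply: ler_sum => j _; exact: step.
rewrite sumr_const card_ord -[leLHS]mulr_natr -mulrA [leRHS]mulrC ler_wpM2l//.
by rewrite mulrAC ler_pdivrMr// ler_wpM2l ?ler_nat// ltW.
Qed.

Lemma is_derive_C1_line (x v : 'rV[R]_n) (s : R) :
  is_derive s 1 (fun t : R => f (x + t *: v))
    (\sum_(i < n) v ord0 i * partial i f (x + s *: v)).
Proof.
set L := \sum_(i < n) _.
suff H : (fun h : R =>
      h^-1 *: (((fun t : R => f (x + t *: v)) \o shift s) (h *: 1) - f (x + s *: v)))
    @ 0^' --> L.
  by apply: DeriveDef; [exact: (cvgP L H)|exact: cvg_lim H].
apply/cvgrPdist_le => e e0.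
(* The added 1 keeps the denominator positive when [v = 0]. *)
have e1 : 0 < e / (`|v| + 1) by rewrite divr_gt0// ltr_wpDl.
have [d d0 H] := C1_differentiable (x + s *: v) _ e1.
near=> h.
have h0 : h != 0 by near: h; exact: nbhs_dnbhs_neq.
have hd : `|h *: v| < d.
  rewrite normrZ (@le_lt_trans _ _ (`|h| * (`|v| + 1)))//.
    by rewrite ler_wpM2l// lerDl.
  rewrite -ltr_pdivlMr ?ltr_wpDl//; near: h.
  apply: dnbhs0_lt; by rewrite divr_gt0// ltr_wpDl.
have E : \sum_(i < n) (h *: v) ord0 i * partial i f (x + s *: v) = h * L.
  by rewrite mulr_sumr; apply: eq_bigr => i _; rewrite mxE mulrA.
have := H _ hd; rewrite E.
rewrite /= [h *: 1]mulr1 scalerDl addrCA [h *: v + _]addrC distrC => {}H.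
rewrite -(ler_pM2l (_ : 0 < `|h|)) ?normr_gt0// -normrM mulrBr.
rewrite [h * (_ *: _)]mulrA mulfV// mul1r (le_trans H)//.
rewrite normrZ mulrCA ler_wpM2l// -mulrA ler_piMr ?ltW//.
by rewrite mulrC ltr_pdivrMr ?ltr_wpDl// mul1r ltrDl.
Unshelve. all: by end_near. Qed.
End C1.

(** * The estimate on a line *)

Section power_mean.
Context {R : realType}.
Local Notation mu := (@lebesgue_measure R).

(** Young's inequality for [y] and 1 gives [y <= y^p / p + (1 - 1/p)]. The case [p = 1] is separate
    because its conjugate exponent is infinite. *)
Lemma powR_bernoulli (p y : R) : 1 <= p -> 0 <= y -> 1 + p * (y - 1) <= y `^ p.
Proof.
move=> p1 y0; have p0 : 0 < p by exact: lt_le_trans p1.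
move: p1; rewrite le_eqVlt => /predU1P[<-|p1].
  by rewrite mul1r addrC subrK powRr1.
have q0 : 0 < 1 - p^-1 by rewrite subr_gt0 invf_lt1.
have := @conjugate_powR R y 1 p (1 - p^-1)^-1 y0 ler01 p0.
rewrite invr_gt0 q0 invrK => /(_ isT).
rewrite (addrC p^-1) subrK => /(_ erefl); rewrite powR1 mulr1 mul1r.
rewrite -(ler_pM2l p0) => h.
rewrite (_ : 1 + _ = p * y - (p - 1)); last by ring.
rewrite lerBlDr (le_trans h)// le_eqVlt; apply/orP; left; apply/eqP.
by field; rewrite gt_eqF.
Qed.

(** Jensen's inequality by a supporting line: with [c] the absolute mean slope, Bernoulli's
    inequality bounds [|g'|^p] below by a function affine in [g'], whose integral the fundamental
    theorem of calculus computes as [(b - a) c^p]. *)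
Lemma power_mean_FTC (p a b : R) (g g' : R -> R) : 1 <= p -> a < b ->
  (forall s : R, is_derive s (1 : R) g (g' s)) -> continuous g' ->
  (((b - a) * (`|g b - g a| / (b - a)) `^ p)%:E <=
    \int[mu]_(s in `[a, b]) (`|g' s| `^ p)%:E)%E.
Proof.
move=> p1 ab dg cg'.
have p0 : 0 < p by exact: lt_le_trans p1.
have ba0 : 0 < b - a by rewrite subr_gt0.
set c := `|g b - g a| / (b - a).
have := divr_ge0 (normr_ge0 (g b - g a)) (ltW ba0); rewrite -/c le_eqVlt => /predU1P[<-|c0].
  rewrite powR0 ?gt_eqF// mulr0; apply: integral_ge0 => x _.
  by rewrite lee_fin powR_ge0.
pose sg := Num.sg (g b - g a).
(* The tangent to [y |-> y^p] at [c], evaluated at [sg * g' x]; the sign makes the mean of [sg * g']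
   equal to [c]. *)
pose l x := c `^ p + p * c `^ p * (sg * g' x / c - 1).
have mf : measurable_fun setT (fun s => (`|g' s| `^ p)%:E).
  apply/measurable_EFinP; apply: (measurableT_comp (measurable_powR p)).
  by apply: measurableT_comp => //; exact: continuous_measurable_fun.
have [foo|] := ltP (\int[mu]_(s in `[a, b]) (`|g' s| `^ p)%:E)%E +oo%E; last first.
  by rewrite leye_eq => /eqP ->; rewrite leey.
have cl : continuous l.
  move=> x; apply: cvgD; first exact: cvg_cst.
  apply: cvgMr; apply: cvgB; last exact: cvg_cst.
  by apply: cvgMl; apply: cvgMr; exact: cg'.
pose G x := (c `^ p - p * c `^ p) * x + p * c `^ p * sg / c * g x.
have dG (x : R) : is_derive x (1 : R) G (l x).
  rewrite (_ : G = ((c `^ p - p * c `^ p) \*: id) + ((p * c `^ p * sg / c) \*: g)); last first.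
    by apply/funext.
  apply: is_derive_eq; rewrite /l /GRing.scale /=; ring.
have intl : (\int[mu]_(s in `[a, b]) (l s)%:E = ((b - a) * c `^ p)%:E)%E.
  rewrite (@continuous_FTC2 R l G a b)//.
  - rewrite -EFinB; congr EFin; rewrite /G.
    have E : sg * (g b - g a) = c * (b - a) by rewrite /sg -normrEsg divfK ?gt_eqF.
    transitivity ((c `^ p - p * c `^ p) * (b - a) +
      p * c `^ p / c * (sg * (g b - g a))); first by ring.
    by rewrite E; field; rewrite gt_eqF.
  - exact: continuous_subspaceT.
  - have cG : continuous G.
      move=> x; apply: differentiable_continuous; apply/derivable1_diffP.
      exact: ex_derive.
    split.
    + by move=> x _; exact: ex_derive.
    + exact/cvg_at_right_filter/cG.
    + exact/cvg_at_left_filter/cG.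
  - by move=> x _; rewrite derive1E; exact: derive_val.
rewrite -intl; apply: le_integral => //.
- apply: continuous_compact_integrable; first exact: segment_compact.
  exact: continuous_subspaceT.
- apply/integrableP; split; first exact: measurable_funTS.
  by under eq_integral do rewrite gee0_abs ?lee_fin ?powR_ge0//.
- move=> x _; rewrite lee_fin /l.
  rewrite -[X in _ <= X `^ _](@divfK _ c) ?gt_eqF// [leRHS]powRM ?divr_ge0 ?(ltW c0) ?(ltW ba0)//.
  (* Bernoulli's inequality at [|g' x| / c], preceded by [sg * g' x <= |g' x|]. *)
  apply: (@le_trans _ _ ((1 + p * (`|g' x| / c - 1)) * c `^ p)); last first.
    by rewrite ler_wpM2r ?powR_ge0// powR_bernoulli// divr_ge0// (ltW c0).
  rewrite mulrDl mul1r lerD2l [leRHS]mulrAC ler_wpM2l ?mulr_ge0 ?powR_ge0 ?(ltW p0)//.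
  rewrite lerD2r ler_wpM2r ?invr_ge0 ?(ltW c0)//.
  rewrite (le_trans (ler_norm _))// normrM ler_piMl// /sg.
  by rewrite normr_sg; case: eqP.
Qed.

End power_mean.

(** * A weighted covering estimate on the line *)

Section vitali_weighted.
Context {R : realType}.
Local Notation mu := (@lebesgue_measure R).
Local Notation RR := (measurableTypeR R * measurableTypeR R)%type.
Local Open Scope ereal_scope.

(** Turns the countable family selected by Vitali's lemma into a series over the naturals; indices
    outside [Q] will contribute zero. *)
Lemma countable_nat_index (T : pointedType) (D : set T) : countable D ->
  exists (Q : set nat) (j : nat -> T),
    [/\ forall n, Q n -> D (j n), forall i, D i -> exists2 n, Q n & j n = i
      & forall n m, Q n -> Q m -> j n = j m -> n = m].
Proof.
move=> /countable_injP[h hinj].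
pose j n := xget point [set i | D i /\ h i = n].
have jP i : D i -> D (j (h i)) /\ h (j (h i)) = h i.
  by rewrite /j; case: xgetP => [y -> //|/(_ i)/= ni Di]; exfalso; exact: ni.
exists (h @` D), j; split.
- by move=> n [i Di <-]; have [] := jP i Di.
- move=> i Di; exists (h i); first by exists i.
  have [? ?] := jP i Di; apply: hinj => //; exact/mem_set.
- move=> _ _ [i1 Di1 <-] [i2 Di2 <-] E.
  by have [_ <-] := jP _ Di1; have [_ <-] := jP _ Di2; rewrite E.
Qed.

(** A pair [(s, t)] stands for the interval joining [s] to [s + t]. Pairs whose interval lies in the
    dilate of a selected interval of radius [r] have weighted measure of order [r^(k+2)], which the
    hypothesis bounds by the mass of [f] on that interval; the selected intervals are disjoint. *)
Lemma vitali_weighted (k : nat) (m : R) (f : R -> \bar R) (V : set RR) :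
  (0 < m)%R -> measurable_fun setT f -> (forall x, 0 <= f x) ->
  measurable V ->
  (forall z, V z -> z.2 != 0%R /\
    (m * `|z.2| ^+ k.+2)%:E <=
      \int[mu]_(x in closed_ball (z.1 + z.2 / 2)%R (`|z.2| / 2)%R) f x) ->
  \int[mu]_s \int[mu]_t (`|t| ^+ k * \1_V (s, t))%:E <=
    (20 * 2 ^+ k / m)%:E * \int[mu]_x f x.
Proof.
move=> m0 mf f0 mV VP.
have C0 : (0 < 20 * 2 ^+ k / m)%R by rewrite divr_gt0 ?mulr_gt0 ?exprn_gt0.
have [foo|] := ltP (\int[mu]_x f x) +oo; last first.
  by rewrite leye_eq => /eqP ->; rewrite gt0_muley ?lte_fin// leey.
pose K := fine (\int[mu]_x f x).
have KE : \int[mu]_x f x = K%:E.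
  by rewrite /K fineK// ge0_fin_numE// integral_ge0.
have ballf (c r : R) : \int[mu]_(x in closed_ball c r) f x <= K%:E.
  rewrite -KE; apply: ge0_subset_integral => //; exact: measurable_closed_ball.
pose ctr (z : RR) : R := (z.1 + z.2 / 2)%R.
(* The value 1 at [t = 0] is a dummy: the radii passed to Vitali's lemma must be positive at every
   pair, also outside [V]. *)
pose rad (z : RR) : R := if z.2 == 0%R then 1%R else (`|z.2| / 2)%R.
have rad0 z : (0 < rad z)%R.
  by rewrite /rad; case: eqVneq => // z2; rewrite divr_gt0// normr_gt0.
have Vrad z : V z -> (`|z.2| = 2 * rad z)%R.
  by move=> /VP[z2 _]; rewrite /rad (negbTE z2) mulrC divfK.
pose B (z : RR) : set R := ball (ctr z) (rad z).
have radB z : ((radius (B z))%:num = rad z)%R by rewrite radius_ball_num// ltW.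
have clB z : closure (B z) = closed_ball (ctr z) (rad z).
  rewrite is_ball_closure; last exact: is_ball_ball.
  by rewrite (cpoint_ball _ (rad0 z)) radB.
have VB z : V z -> (m * (2 * rad z) ^+ k.+2)%:E <=
      \int[mu]_(x in closed_ball (ctr z) (rad z)) f x.
  move=> Vz; have [z2] := VP _ Vz; rewrite -(Vrad _ Vz) /rad (negbTE z2).
  exact.
(* Vitali's lemma needs bounded radii. If [r > 1], then [2 r <= (2 r)^(k+2) <= K / m]. *)
have Vbound z : V z -> ((radius (B z))%:num <= 1 + K / m)%R.
  move=> Vz; rewrite radB.
  have Km : (0 <= K / m)%R by rewrite divr_ge0 ?(ltW m0)// /K fine_ge0// integral_ge0.
  have [r1|r1] := leP (rad z) 1%R; first by rewrite (le_trans r1)// lerDl.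
  have := le_trans (VB _ Vz) (ballf _ _); rewrite lee_fin -ler_pdivlMl// [leRHS]mulrC => h.
  apply: (@le_trans _ _ (K / m)%R); last by rewrite lerDr.
  apply: le_trans h; apply: (@le_trans _ _ (2 * rad z)%R).
    by rewrite ler_peMl ?(ltW (rad0 _))// ler1n.
  by rewrite ler_eXnr// (le_trans (ltW r1))// ler_peMl ?(ltW (rad0 _))// ler1n.
have [D [cD DV tD Dcover]] := @vitali_lemma_infinite R RR B V (1 + K / m)%R
  (fun z => is_ball_ball _ _) (fun z => eq_ind_r (fun x => (0 < x)%R) (rad0 z) (radB z)) Vbound.
have [Q [j [QD DQ Qinj]]] := countable_nat_index _ _ cD.
(* A pair of [V] attached to the [n]-th selected interval has [s] in its 5-fold dilate, and [|t|] at
   most 4 times its radius since radii are comparable up to a factor 2. Hence [A n] times [T n]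
   contains it. *)
pose A n : set R := if `[< Q n >] then closed_ball (ctr (j n)) (5 * rad (j n))%R else set0.
pose T n : set R := `[(- (4 * rad (j n)))%R, (4 * rad (j n))%R]%classic.
pose W n : set R := if `[< Q n >] then closed_ball (ctr (j n)) (rad (j n)) else set0.
have mA n : measurable (A n) by rewrite /A; case: ifPn => // _; exact: measurable_closed_ball.
have mW n : measurable (W n) by rewrite /W; case: ifPn => // _; exact: measurable_closed_ball.
have mT n : measurable (T n) by exact: measurable_itv.
have mAT n : measurable (A n `*` T n : set RR) := measurableX (mA n) (mT n).
pose phi n (z : RR) : \bar R := ((4 * rad (j n)) ^+ k * \1_(A n `*` T n) z)%:E.
have phi0 n z : 0 <= phi n z.
  by rewrite lee_fin mulr_ge0// exprn_ge0// mulr_ge0// ltW.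
have mphi n : measurable_fun setT (phi n).
  apply/measurable_EFinP; exact: measurable_funM.
have mh : measurable_fun setT (fun z : RR => (`|z.2| ^+ k * \1_V z)%:E).
  apply/measurable_EFinP; apply: measurable_funM; last exact: measurable_indic.
  by apply: measurable_funX; apply: measurableT_comp => //; exact: measurable_snd.
have h0 (z : RR) : 0 <= (`|z.2| ^+ k * \1_V z)%:E.
  by rewrite lee_fin mulr_ge0// exprn_ge0.
rewrite -(fubini_tonelli1 (fun z : RR => (`|z.2| ^+ k * \1_V z)%:E))//.
apply: (@le_trans _ _ (\int[mu \x mu]_z \sum_(n <oo) phi n z)).
  apply: ge0_le_integral => //.
    exact: ge0_emeasurable_sum.
  move=> z _; have [Vz|Vz] := pselect (V z); last first.
    rewrite indicE memNset// mulr0; exact: nneseries_ge0.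
  rewrite indicE mem_set// mulr1.
  have [i [Di _ ri sub]] := Dcover _ Vz; have [n Qn jn] := DQ _ Di.
  apply: (@le_trans _ _ (phi n z)).
    move: ri; rewrite !radB (ler_pdivrMr _ _ (ltr0Sn R 1)) mulrC => ri.
    have z24 : (`|z.2| <= 4 * rad (j n))%R.
      by rewrite (Vrad _ Vz) jn (_ : 4 = 2 * 2)%R -?mulrA ?ler_pM2l// -natrM.
    rewrite /phi indicE mem_set ?mulr1.
      by rewrite lee_fin lerXn2r// nnegrE mulr_ge0// ltW.
    split; last by rewrite /T /= in_itv/= -ler_norml.
    rewrite /A; case: asboolP => // _; rewrite jn.
    have : closure (B z) z.1.
      rewrite clB closed_ballE// /closed_ball_/= /ctr.
      rewrite addrAC subrr add0r normrM (Vrad _ Vz) mulrAC.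
      by rewrite (@ger0_norm _ 2^-1%R)// mulfV ?mul1r.
    by move=> /sub; rewrite scale_ballE//.
  rewrite (@nneseriesD1 R (phi^~ z) n)//.
  by rewrite leeDl// nneseries_ge0.
rewrite integral_nneseries//.
apply: (@le_trans _ _ (\sum_(n <oo) ((20 * 2 ^+ k / m)%:E * \int[mu]_(x in W n) f x))).
  apply: lee_nneseries => [n *|n *]; first exact: integral_ge0.
  rewrite /phi; under eq_integral do rewrite EFinM.
  rewrite ge0_integralZl//; last 2 first.
    by apply/measurable_EFinP; apply: measurable_indic; exact: mAT.
    by rewrite lee_fin exprn_ge0// mulr_ge0// ltW.
  rewrite integral_indic//.
  rewrite [X in _ * X <= _](_ : _ = mu (A n) * mu (T n)); last first.
    by rewrite setIT; exact (@product_measure1E _ _ _ _ _ mu mu _ _ (mA n) (mT n)).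
  rewrite /A /W.
  case: asboolP => Qn; last first.
    by rewrite measure0 mul0e mule0 integral_set0 mule0.
  rewrite lebesgue_measure_closed_ball ?mulr_ge0 ?(ltW (rad0 _))// /T lebesgue_measure_itv/=.
  rewrite lte_fin -subr_gt0 opprK ifT ?addr_gt0 ?mulr_gt0//.
  have := VB _ (DV _ (QD _ Qn)).
  set I := (X in _ <= X -> _) => h.
  (* With [r] the radius, [(4r)^k * 10r * 8r = 20 * 2^k * (2r)^(k+2)]. *)
  apply: (@le_trans _ _ ((20 * 2 ^+ k / m)%:E * (m * (2 * rad (j n)) ^+ k.+2)%:E)).
    rewrite -EFinD -!EFinM lee_fin.
    rewrite le_eqVlt; apply/orP; left; apply/eqP.
    rewrite !exprMn (_ : 4 = 2 * 2)%R ?exprMn; last by rewrite -natrM.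
    rewrite !exprS; field. 
    by rewrite gt_eqF.
  by rewrite lee_wpmul2l// lee_fin ltW.
rewrite nneseriesZl//; last by move=> n *; exact: integral_ge0.
(* Vitali's lemma makes the closures of the selected balls disjoint, so the integrals over the [W n]
   add up to an integral over their union. *)
rewrite lee_wpmul2l ?lee_fin ?(ltW C0)// -ge0_integral_bigcup//.
- apply: ge0_subset_integral => //; apply: bigcup_measurable => n _; exact: mW.
- exact: measurable_funTS.
- apply/trivIsetP => a b _ _ ab; rewrite /W.
  case: asboolP => Qa; last by rewrite set0I.
  case: asboolP => Qb; last by rewrite setI0.
  have jab : j a != j b by apply: contra_neq ab => /Qinj; exact.
  have /trivIsetP/(_ _ _ (QD _ Qa) (QD _ Qb) jab) := tD.
  by rewrite /= !clB.
Qed.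

End vitali_weighted.

(** * The Euclidean norm *)

Section enorm_theory.
Context {R : realType} {n : nat}.
Implicit Types (x y v : 'rV[R]_n).

Lemma enorm_ge0 x : 0 <= enorm x.
Proof. exact: sqrtr_ge0. Qed.

Lemma enorm_sqr x : enorm x ^+ 2 = \sum_(i < n) x ord0 i ^+ 2.
Proof. by rewrite sqr_sqrtr// sumr_ge0// => i _; exact: sqr_ge0. Qed.

Lemma enormZ (t : R) x : enorm (t *: x) = `|t| * enorm x.
Proof.
rewrite /enorm -sqrtr_sqr -sqrtrM ?sqr_ge0// mulr_sumr; congr Num.sqrt.
by apply: eq_bigr => i _; rewrite mxE exprMn.
Qed.

Lemma enormN x : enorm (- x) = enorm x.
Proof. by rewrite -scaleN1r enormZ normrN1 mul1r. Qed.

Lemma ler_coord_enorm x i : `|x ord0 i| <= enorm x.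
Proof.
rewrite -sqrtr_sqr; apply: ler_wsqrtr; rewrite (bigD1 i)//= lerDl.
by apply: sumr_ge0 => j _; exact: sqr_ge0.
Qed.

Lemma enorm_eq0 x : (enorm x == 0) = (x == 0).
Proof.
apply/eqP/eqP => [x0|->]; last by rewrite -(scale0r 0) enormZ normr0 mul0r.
apply/rowP => i; rewrite mxE; apply/eqP; rewrite -normr_le0 -x0.
exact: ler_coord_enorm.
Qed.

Lemma enorm_gt0 x : (0 < enorm x) = (x != 0).
Proof. by rewrite lt_def enorm_eq0 enorm_ge0 andbT. Qed.

(** Cauchy-Schwarz: normalize both vectors and sum [|a b| <= (a^2 + b^2) / 2] over the
    coordinates. *)
Lemma dot_le_enorm x y : `|\sum_(i < n) x ord0 i * y ord0 i| <= enorm x * enorm y.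
Proof.
have [->|x0] := eqVneq x 0.
  rewrite big1 ?normr0 ?mulr_ge0 ?enorm_ge0// => i _.
  by rewrite mxE mul0r.
have [->|y0] := eqVneq y 0.
  rewrite big1 ?normr0 ?mulr_ge0 ?enorm_ge0// => i _.
  by rewrite mxE mulr0.
have ex : 0 < enorm x by rewrite enorm_gt0.
have ey : 0 < enorm y by rewrite enorm_gt0.
have exy : 0 < enorm x * enorm y by rewrite mulr_gt0.
rewrite -[leRHS]mul1r -ler_pdivrMr// -[X in _ / X]gtr0_norm// -normfV -normrM.
rewrite mulr_suml (le_trans (ler_norm_sum _ _ _))//.
have E (z : 'rV[R]_n) : z != 0 -> \sum_(i < n) (z ord0 i / enorm z) ^+ 2 = 1.
  rewrite -enorm_gt0 => z0; under eq_bigr do rewrite expr_div_n.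
  by rewrite -mulr_suml -enorm_sqr divff// gt_eqF// exprn_gt0.
rewrite (_ : 1 = \sum_(i < n)
    ((x ord0 i / enorm x) ^+ 2 + (y ord0 i / enorm y) ^+ 2) / 2); last first.
  by rewrite -mulr_suml big_split/= !E// divff.
apply: ler_sum => i _.
rewrite (_ : x ord0 i * y ord0 i / _ = (x ord0 i / enorm x) * (y ord0 i / enorm y)); last first.
  by field; rewrite !gt_eqF.
set a := _ / enorm x; set b := _ / enorm y.
rewrite ler_norml; apply/andP; split; rewrite -subr_ge0.
  rewrite (_ : _ - _ = (a + b) ^+ 2 / 2); last by field.
  by rewrite divr_ge0// sqr_ge0.
rewrite (_ : _ - _ = (a - b) ^+ 2 / 2); last by field.
by rewrite divr_ge0// sqr_ge0.
Qed.

Lemma enorm_le_coord x (b : R) : 0 <= b ->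
  (forall i, `|x ord0 i| <= b) -> enorm x <= n%:R * b.
Proof.
move=> b0 xb; rewrite -(@ler_pXn2r _ 2)// ?nnegrE ?enorm_ge0 ?mulr_ge0//.
rewrite enorm_sqr (@le_trans _ _ (\sum_(i < n) b ^+ 2))//.
  by apply: ler_sum => i _; rewrite -real_normK ?num_real// lerXn2r// ?nnegrE.
rewrite sumr_const card_ord -[leLHS]mulr_natl exprMn ler_wpM2r ?sqr_ge0//.
case: (n) => [|m]; first by rewrite expr0n.
by rewrite -natrX ler_nat expnS expn1 leq_pmulr.
Qed.

Lemma enormD x y : enorm (x + y) <= enorm x + enorm y.
Proof.
rewrite -(@ler_pXn2r _ 2)// ?nnegrE ?addr_ge0 ?enorm_ge0//.
rewrite enorm_sqr sqrrD !enorm_sqr.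
under eq_bigr => i _ do rewrite mxE sqrrD.
rewrite !big_split/= lerD2r lerD2l -mulr2n lerMn2r/=.
exact: le_trans (ler_norm _) (dot_le_enorm _ _).
Qed.

Lemma norm_le_enorm x : `|x| <= enorm x.
Proof.
rewrite [leLHS]mx_normrE; apply: bigmax_le; first exact: enorm_ge0.
by move=> [i j] _ /=; rewrite (ord1 i); exact: ler_coord_enorm.
Qed.

End enorm_theory.

(** * Superlevel sets on a line *)

Section line_estimate.
Context {R : realType}.
Local Notation mu := (@lebesgue_measure R).
Local Notation RR := (measurableTypeR R * measurableTypeR R)%type.

(** Product form of the superlevel condition. At [t = 0] the inequality reads [0 <= 0] for nonzero
    [q], so the diagonal is removed explicitly. *)
Definition line_level (l q : R) (g : R -> R) : set (R * R) :=
  [set z | z.2 != 0 /\ l * `|z.2| `^ q <= `|g (z.1 + z.2) - g z.1|].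

Lemma measurable_line_level (l q : R) (g : R -> R) :
  measurable_fun setT g -> measurable (line_level l q g : set RR).
Proof.
move=> mg.
have m1 : measurable_fun [set: RR] (fun z => `|g (z.1 + z.2) - g z.1|).
  apply: (measurableT_comp (@normr_measurable R setT)).
  apply: measurable_funB; last exact: (measurableT_comp mg measurable_fst).
  apply: (measurableT_comp mg); apply: measurable_funD; first exact: measurable_fst.
  exact: measurable_snd.
have m2 : measurable_fun [set: RR] (fun z => l * `|z.2| `^ q).
  apply: measurable_funM => //; apply: (measurableT_comp (measurable_powR q)).
  exact: (measurableT_comp (@normr_measurable R setT) measurable_snd).
rewrite (_ : line_level _ _ _ =
    (snd @^-1` (~` [set 0])) `&`
    ((fun z : RR => `|g (z.1 + z.2) - g z.1| - l * `|z.2| `^ q)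
       @^-1` `[0, +oo[)); last first.
  apply/seteqP; split => z /=; rewrite in_itv/= andbT subr_ge0.
    by move=> [/eqP].
  by move=> [/eqP].
apply: measurableI; rewrite -[X in measurable X]setTI.
  by apply: (@measurable_snd _ _ (measurableTypeR R) (measurableTypeR R)) => //; exact: measurableC.
by apply: (measurable_funB m1 m2) => //; exact: measurable_itv.
Qed.

Lemma line_estimate (k : nat) (p l : R) (g g' : R -> R) : 1 <= p -> 0 < l ->
  (forall s : R, is_derive s (1 : R) g (g' s)) -> continuous g' ->
  (\int[mu]_s \int[mu]_t (`|t| ^+ k * \1_(line_level l (k.+1%:R / p + 1) g) (s, t))%:E <=
    (20 * 2 ^+ k / l `^ p)%:E * \int[mu]_s (`|g' s| `^ p)%:E)%E.
Proof.
move=> p1 l0 dg cg'.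
have p0 : 0 < p by exact: lt_le_trans p1.
have cg : continuous g.
  move=> x; apply: differentiable_continuous; apply/derivable1_diffP.
  exact: ex_derive.
apply: vitali_weighted.
- exact: powR_gt0.
- apply/measurable_EFinP; apply: (measurableT_comp (measurable_powR p)).
  by apply: measurableT_comp => //; exact: continuous_measurable_fun.
- by move=> x; rewrite lee_fin powR_ge0.
- by apply: measurable_line_level; exact: continuous_measurable_fun.
move=> [s t] /= [t0 lt]; split => //.
have nt0 : 0 < `|t| by rewrite normr_gt0.
rewrite closed_ball_itv ?divr_gt0//.
(* Dividing by [|t|] lowers the exponent to [(k+1)/p], so the [p]-th power is [l^p |t|^(k+1)]; the
   length [|t|] of the interval supplies the last factor. This is the hypothesis of
   [vitali_weighted] with [m = l^p]. *)
have powE (d : R) : l * `|t| `^ (k.+1%:R / p + 1) <= d ->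
    l `^ p * `|t| ^+ k.+2 <= `|t| * (d / `|t|) `^ p.
  move=> ld.
  have -> : l `^ p * `|t| ^+ k.+2 = `|t| * (l * `|t| `^ (k.+1%:R / p)) `^ p.
    rewrite powRM ?powR_ge0// ?(ltW l0)// -powRrM divfK ?gt_eqF// powR_mulrn//.
    by rewrite [RHS]mulrCA -exprS.
  have h0 : 0 <= l * `|t| `^ (k.+1%:R / p) by rewrite mulr_ge0 ?powR_ge0 ?(ltW l0).
  have h1 : l * `|t| `^ (k.+1%:R / p) <= d / `|t|.
    rewrite ler_pdivlMr// (le_trans _ ld)// -mulrA ler_pM2l//.
    by rewrite powRD ?(gt_eqF nt0) ?implybT// powRr1.
  rewrite ler_pM2l//; apply: ge0_ler_powR; rewrite ?nnegrE ?(ltW p0)//.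
  exact: le_trans h1.
move: lt => /powE/=; have [tpos|tneg|/eqP] := ltgtP 0 t; last by rewrite eq_sym (negbTE t0).
- rewrite gtr0_norm// => h.
  have -> : s + t / 2 - t / 2 = s by rewrite addrK.
  have -> : s + t / 2 + t / 2 = s + t by rewrite -addrA -splitr.
  have st : s < s + t by rewrite ltrDl.
  apply: le_trans (power_mean_FTC _ _ _ _ _ p1 st dg cg').
  by rewrite lee_fin (addrC s) addrK addrC.
- rewrite ltr0_norm// => h.
  have -> : s + t / 2 - - t / 2 = s + t by rewrite mulNr opprK -addrA -splitr.
  have -> : s + t / 2 + - t / 2 = s by rewrite mulNr addrK.
  have st : s + t < s by rewrite gtrDl.
  apply: le_trans (power_mean_FTC _ _ _ _ _ p1 st dg cg').
  by rewrite lee_fin opprD addrA subrr add0r distrC.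
Qed.

End line_estimate.

(** * The upper bound *)

Section smooth_facts.
Context {R : realType} {n : nat}.
Variable u : 'rV[R]_n -> R.
Hypothesis su : smooth u.

Lemma smooth_continuous : continuous u.
Proof. by have [] := su [::]. Qed.

Lemma smooth_derivable i x : derivable u x (basis_vec i).
Proof. by have [_] := su [::]; exact. Qed.

Lemma smooth_partial_continuous i : continuous (partial i u).
Proof. by have [] := su [:: i]. Qed.

Lemma measurable_enorm_gradient : measurable_fun setT (fun x => enorm (gradient u x)).
Proof.
apply: (measurableT_comp (measurable_enorm _)).
apply/measurable_fun_coordP => i; under eq_fun do rewrite mxE.
apply: continuous_measurable_rV; exact: smooth_partial_continuous.
Qed.

Lemma measurable_gradient_powR (p : R) :
  measurable_fun setT (fun x => (enorm (gradient u x) `^ p)%:E).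
Proof.
apply/measurable_EFinP; apply: (measurableT_comp (measurable_powR p)).
exact: measurable_enorm_gradient.
Qed.

End smooth_facts.

(** * Superlevel sets of the difference quotient *)

Section superlevel.
Context {R : realType} {n : nat}.
Local Notation VV := ('rV[R]_n * 'rV[R]_n)%type.
Variables (p l : R) (u : 'rV[R]_n -> R).
Hypotheses (p0 : 0 < p) (l0 : 0 < l).

(** Clearing the denominator is legitimate off the diagonal; on it the quotient is 0 by convention,
    below the positive level. *)
Lemma diff_quotient_superlevelE : [set z : VV | l <= `|diff_quotient p u z|] =
  [set z : VV | enorm (z.1 - z.2) != 0 /\
    l * enorm (z.1 - z.2) `^ (n%:R / p + 1) <= `|u z.1 - u z.2|].
Proof.
have q0 : 0 < n%:R / p + 1 by rewrite ltr_wpDl// divr_ge0// ltW.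
apply/seteqP; split => z /=; rewrite /diff_quotient normrM normfV
    (ger0_norm (powR_ge0 (enorm _) _)).
  case: eqVneq => [->|z0].
    by rewrite powR0 ?gt_eqF// invr0 mulr0 leNgt l0.
  by rewrite ler_pdivlMr// powR_gt0// lt_def z0 enorm_ge0.
move=> [z0].
by rewrite ler_pdivlMr// powR_gt0// lt_def z0 enorm_ge0.
Qed.

Lemma measurable_diff_quotient_superlevel : measurable_fun setT u ->
  measurable [set z : VV | l <= `|diff_quotient p u z|].
Proof.
move=> mu; rewrite diff_quotient_superlevelE.
have me : measurable_fun [set: VV] (fun z => enorm (z.1 - z.2)).
  apply: (measurableT_comp (measurable_enorm _)).
  apply/measurable_fun_coordP => i; under eq_fun do rewrite !mxE.
  apply: measurable_funB.
    exact: (measurableT_comp (measurable_coord i) measurable_fst).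
  exact: (measurableT_comp (measurable_coord i) measurable_snd).
have m1 : measurable_fun [set: VV] (fun z => `|u z.1 - u z.2|).
  apply: (measurableT_comp (@normr_measurable R setT)).
  apply: measurable_funB; first exact: (measurableT_comp mu measurable_fst).
  exact: (measurableT_comp mu measurable_snd).
have m2 : measurable_fun [set: VV] (fun z => l * enorm (z.1 - z.2) `^ (n%:R / p + 1)).
  by apply: measurable_funM => //; apply: (measurableT_comp (measurable_powR _)).
rewrite (_ : [set z : VV | _ /\ _] =
    ((fun z : VV => enorm (z.1 - z.2)) @^-1` (~` [set 0])) `&`
    ((fun z : VV => `|u z.1 - u z.2| - l * enorm (z.1 - z.2) `^ (n%:R / p + 1))
       @^-1` `[0, +oo[)); last first.
  apply/seteqP; split => z /=; rewrite in_itv/= andbT subr_ge0.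
    by move=> [/eqP].
  by move=> [/eqP].
apply: measurableI; rewrite -[X in measurable X]setTI.
  by apply: me => //; exact: measurableC.
by apply: (measurable_funB m1 m2) => //; exact: measurable_itv.
Qed.

End superlevel.

Lemma integral_indicT d (T : measurableType d) (R : realType)
    (mu : {sigma_finite_measure set T -> \bar R}) (A : set T) :
  measurable A -> (\int[mu]_x (\1_A x)%:E = mu A)%E.
Proof. by move=> mA; rewrite integral_indic// setIT. Qed.

Lemma product_measure_integral d1 d2 (T1 : measurableType d1)
    (T2 : measurableType d2) (R : realType)
    (m1 : {sigma_finite_measure set T1 -> \bar R})
    (m2 : {sigma_finite_measure set T2 -> \bar R}) (A : set (T1 * T2)) :
  measurable A ->
  ((m1 \x m2) A = \int[m1]_x \int[m2]_y (\1_A (x, y))%:E)%E.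
Proof.
move=> mA; rewrite -(fubini_tonelli1 (fun z => (\1_A z)%:E))//.
  by rewrite integral_indic// setIT.
by apply/measurable_EFinP; exact: measurable_indic.
Qed.

(** * The integral over directions *)

Section direction_integral.
Context {R : realType}.
Local Notation mu := (@lebesgue_measure R).
Local Notation e_ v := (rV_cons (1, v)).

Lemma enorm_dir_gt0 n (v : 'rV[R]_n) : 0 < enorm (e_ v).
Proof.
rewrite enorm_gt0; apply/eqP => /rowP/(_ ord0)/eqP.
by rewrite rV_cons0 mxE oner_eq0.
Qed.

Lemma lebesgue_rV_cube n (a b : R) : a < b ->
  lebesgue_rV n [set v : 'rV[R]_n | forall i, `[a, b]%classic (v ord0 i)] =
  ((b - a) ^+ n)%:E.
Proof.
move=> ab; rewrite (@lebesgue_rV_box R n (fun=> `[a, b]%classic))//.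
under eq_bigr do rewrite lebesgue_measure_itv/= lte_fin ab -EFinD.
by rewrite prodEFin prodr_const card_ord.
Qed.

Lemma measurable_cube n (a b : R) :
  measurable [set v : 'rV[R]_n | forall i, `[a, b]%classic (v ord0 i)].
Proof. by apply: (measurable_rV_box (fun=> `[a, b]%classic)) => i; exact: measurable_itv. Qed.

Lemma measurable_dir n :
  measurable_fun setT (fun v : 'rV[R]_n => (enorm (e_ v) ^- n.+1)%:E).
Proof.
apply/measurable_EFinP.
rewrite (_ : (fun _ => _) = (fun v : 'rV[R]_n => enorm (e_ v) `^ (- n.+1%:R))); last first.
  by apply/funext => v; rewrite powR_invn// enorm_ge0.
apply: (measurableT_comp (measurable_powR _)).
by apply: (measurableT_comp (measurable_enorm _)); exact: measurable_rV_consT.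
Qed.

(* Both sides of the change of variables [integral_rV_polar] are evaluated on
   the indicator of [0, 1]^N x [-1, 2]^N: if x is in the unit cube, then y is in
   the large one as soon as |y - x| <= 1. *)
Lemma integral_dir_le n :
  (\int[lebesgue_rV n]_v ((enorm (e_ v) ^- n.+1)%:E) <= (6 ^+ n.+1)%:E :> \bar R)%E.
Proof.
pose Q : set 'rV[R]_n.+1 := [set v | forall i, `[0, 1]%classic (v ord0 i)].
pose Q3 : set 'rV[R]_n.+1 := [set v | forall i, `[-1, 2]%classic (v ord0 i)].
have mQ : measurable Q by exact: measurable_cube.
have mQ3 : measurable Q3 by exact: measurable_cube.
have QE : lebesgue_rV n.+1 Q = 1%E by rewrite lebesgue_rV_cube// subr0 expr1n.
have Q3E : lebesgue_rV n.+1 Q3 = (3 ^+ n.+1)%:E.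
  by rewrite lebesgue_rV_cube; [rewrite (_ : 2 - -1 = 3 :> R)//; ring|lra].
pose F (z : 'rV[R]_n.+1 * 'rV[R]_n.+1) : \bar R := (\1_Q z.1 * \1_Q3 z.2)%:E.
have mF : measurable_fun setT F.
  apply/measurable_EFinP; apply: measurable_funM.
    exact: (measurableT_comp (measurable_indic mQ) measurable_fst).
  exact: (measurableT_comp (measurable_indic mQ3) measurable_snd).
have F0 z : (0 <= F z)%E by rewrite lee_fin mulr_ge0.
have FE : (\int[lebesgue_rV n.+1]_x \int[lebesgue_rV n.+1]_y F (x, y) = (3 ^+ n.+1)%:E)%E.
  move: QE Q3E; generalize (@lebesgue_rV R n.+1) => L QE Q3E.
  transitivity (\int[L]_x ((3 ^+ n.+1)%:E * (\1_Q x)%:E))%E.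
    apply: eq_integral => x _; rewrite /F /=.
    under eq_integral do rewrite EFinM.
    rewrite ge0_integralZl//; last exact/measurable_EFinP/measurable_indic.
    by rewrite integral_indicT// Q3E muleC.
  rewrite ge0_integralZl//; [|exact/measurable_EFinP/measurable_indic].
  by rewrite integral_indicT// QE mule1.
have -> : (6 ^+ n.+1)%:E = ((2 ^+ n.+1)%:E * (3 ^+ n.+1)%:E)%E :> \bar R.
  by rewrite -EFinM -exprMn -natrM.
rewrite -FE integral_rV_polar//.
have mH : measurable_fun setT (fun v : 'rV[R]_n => \int[lebesgue_rV n.+1]_x \int[mu]_t
    ((`|t| ^+ n)%:E * F (x, (x + t *: e_ v)%R)))%E.
  apply: (measurable_fun_fubini_tonelli_G (m1 := lebesgue_rV n.+1) _
    (measurable_integral_polar _ _ mF F0)) => z.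
  by apply: integral_ge0 => t _; rewrite mule_ge0// lee_fin exprn_ge0.
have H0 (v : 'rV[R]_n) : (0 <= \int[lebesgue_rV n.+1]_x \int[mu]_t
    ((`|t| ^+ n)%:E * F (x, (x + t *: e_ v)%R)))%E.
  apply: integral_ge0 => x _; apply: integral_ge0 => t _.
  by rewrite mule_ge0// lee_fin exprn_ge0.
rewrite -ge0_integralZl//.
apply: ge0_le_integral => //.
- by move=> v _; rewrite lee_fin invr_ge0 exprn_ge0// enorm_ge0.
- exact: measurable_dir.
- exact: measurable_funeM.
move=> v _; have e0 := enorm_dir_gt0 n v; set e := e_ v in e0 *.
(* For [t] in [[a, 2a]] the step [t e] has length at most 1, so it leads from [Q] into [Q3]. The
   weight is at least [a^n] and the interval has length [a], giving [a^(n+1)]; hence a factor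
   [2^(n+1)], beside the volume [3^(n+1)] of [Q3]. *)
pose a : R := (2 * enorm e)^-1.
have a0 : 0 < a by rewrite invr_gt0 mulr_gt0.
have -> : (enorm e ^- n.+1)%:E = ((2 ^+ n.+1)%:E * (a ^+ n.+1)%:E)%E.
  by rewrite -EFinM /a exprVn exprMn invfM mulrA divff ?mul1r// expf_neq0.
rewrite lee_wpmul2l//.
apply: (@le_trans _ _ (\int[lebesgue_rV n.+1]_x ((a ^+ n.+1)%:E * (\1_Q x)%:E))%E).
  move: QE; generalize (@lebesgue_rV R n.+1) => L QE.
  rewrite ge0_integralZl//;
    [|exact/measurable_EFinP/measurable_indic|by rewrite lee_fin exprn_ge0// ltW].
  by rewrite integral_indicT// QE mule1.
have mx : measurable_fun setT (fun x : 'rV[R]_n.+1 => (x, v)).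
  exact/measurable_fun_pair.
apply: ge0_le_integral => //.
- by move=> x _; rewrite -EFinM lee_fin mulr_ge0// exprn_ge0// ltW.
- by apply: measurable_funeM; exact/measurable_EFinP/measurable_indic.
- exact: (measurableT_comp (measurable_integral_polar _ _ mF F0) mx).
move=> x _.
pose T : set R := `[a, 2 * a]%classic.
have mT : measurable T by exact: measurable_itv.
have mT1 : measurable_fun setT (fun t : measurableTypeR R => (\1_T t)%:E : \bar R).
  by apply/measurable_EFinP; exact: measurable_indic.
have aT : a < 2 * a by rewrite ltr_pMl// ltr1n.
apply: (@le_trans _ _ (\int[mu]_t ((a ^+ n * \1_Q x)%:E * (\1_T t)%:E))%E).
  rewrite ge0_integralZl//; last by rewrite lee_fin mulr_ge0// exprn_ge0// ltW.
  rewrite (_ : \int[mu]_t (\1_T t)%:E = a%:E)%E.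
    by rewrite -!EFinM lee_fin exprSr mulrAC.
  transitivity (mu T); first exact: integral_indicT.
  by rewrite /T lebesgue_measure_itv/= lte_fin aT -EFinD; congr EFin; ring.
have mt : measurable_fun setT (fun t : measurableTypeR R => ((x, v), t)).
  exact/measurable_fun_pair.
apply: ge0_le_integral => //.
- by move=> t _; rewrite -EFinM lee_fin !mulr_ge0// exprn_ge0// ltW.
- exact: (measurable_funeM _ mT1).
- exact: (measurableT_comp (measurable_polar _ _ mF) mt).
move=> t _; rewrite -!EFinM lee_fin /=.
have [tT|tT] := pselect (T t); last first.
  by rewrite (indicE _ T) memNset// mulr0 mulr_ge0 ?mulr_ge0// exprn_ge0.
have [xQ|xQ] := pselect (Q x); last first.
  by rewrite (indicE _ Q) memNset// mulr0 !mul0r mulr0.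
move: tT; rewrite /T/= in_itv/= => /andP[at1 ta].
have t0 : 0 <= t by rewrite (le_trans _ at1)// ltW.
rewrite (indicE _ Q) mem_set// (indicE _ T) mem_set/=; last by rewrite /T/= in_itv/= at1.
rewrite indicE mem_set ?mulr1 ?mul1r.
  by rewrite lerXn2r ?nnegrE ?normr_ge0 ?(ltW a0)// ger0_norm.
move=> i; have := xQ i; rewrite /= !in_itv/= !mxE => /andP[x0 x1].
have : `|t * e ord0 i| <= 1.
  rewrite normrM ger0_norm// (@le_trans _ _ (2 * a * enorm e))//.
    by rewrite ler_pM// ler_coord_enorm.
  rewrite (_ : 2 * a * enorm e = 1)//; rewrite /a; field; exact: lt0r_neq0.
rewrite /e mxE; set y := (t * _); rewrite ler_norml => /andP[y0 y1].
by apply/andP; split; lra.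
Qed.

End direction_integral.

(** * From lines to the whole space *)

Section upper_bound.
Context {R : realType} {n : nat}.
Local Notation mu := (@lebesgue_measure R).
Local Notation L := (@lebesgue_rV R n.+1).
Local Notation e_ v := (rV_cons (1, v)).
Variables (u : 'rV[R]_n.+1 -> R) (p : R).
Hypotheses (su : smooth u) (p1 : 1 <= p).

Let p0 : 0 < p. Proof. exact: lt_le_trans p1. Qed.

Lemma measurable_shear (v : 'rV[R]_n) (f : 'rV[R]_n.+1 -> \bar R) :
  measurable_fun setT f -> measurable_fun setT
    (fun z : 'rV[R]_n * measurableTypeR R => f (rV_cons (0, z.1) + z.2 *: e_ v)).
Proof.
move=> mf; apply: (measurableT_comp mf); apply: measurable_rV_add.
  by apply: measurable_rV_consT => //; exact: measurable_fst.
by apply: measurable_rV_scale => //; exact: measurable_snd.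
Qed.

Lemma measurable_integral_shear (v : 'rV[R]_n) (f : 'rV[R]_n.+1 -> \bar R) :
  measurable_fun setT f -> (forall x, 0 <= f x)%E -> measurable_fun setT
    (fun z : 'rV[R]_n => \int[mu]_s f (rV_cons (0, z) + s *: e_ v)%R)%E.
Proof.
move=> mf f0.
exact: (measurable_fun_fubini_tonelli_F (m2 := mu) _ (measurable_shear v _ mf) (fun=> f0 _)).
Qed.

Lemma continuous_directional (w v : 'rV[R]_n.+1) : continuous
  (fun s : R => \sum_(i < n.+1) v ord0 i * partial i u (w + s *: v)).
Proof.
apply: continuous_big => [|i _ s]; first exact: add_continuous.
apply: cvgMr; apply: (@cvg_comp _ _ _ (fun s : R => w + s *: v) (partial i u)).
  by apply: cvgD; [exact: cvg_cst|apply: cvgZl; exact: cvg_id].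
exact: smooth_partial_continuous.
Qed.

(** The two points are at distance [|t| * enorm v]; the power of [enorm v] is absorbed into the
    level. *)
Lemma superlevel_line (l : R) (w v : 'rV[R]_n.+1) (s t : R) : 0 < l -> v != 0 ->
  [set z | l <= `|diff_quotient p u z|] (w + s *: v, w + s *: v + t *: v) <->
  line_level (l * enorm v `^ (n.+1%:R / p + 1)) (n.+1%:R / p + 1)
    (fun s => u (w + s *: v)) (s, t).
Proof.
move=> l0 v0; rewrite diff_quotient_superlevelE// /line_level /=.
rewrite opprD addrA subrr sub0r enormN enormZ distrC -addrA -scalerDl.
rewrite powRM ?enorm_ge0// [`|t| `^ _ * _]mulrC mulrA.
by rewrite mulf_eq0 normr_eq0 negb_or enorm_eq0 v0 andbT; split => -[].
Qed.

(** Both space integrals are foliated by the lines of direction [(1, v)]; [line_estimate] applies on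
    each, and Cauchy-Schwarz bounds the derivative along the line by the gradient. *)
Lemma superlevel_dir_le (l : R) (v : 'rV[R]_n) : 0 < l ->
  (\int[L]_x \int[mu]_t ((`|t| ^+ n)%:E *
     (\1_([set z | l <= `|diff_quotient p u z|]) (x, x + t *: e_ v))%:E)
   <= (20 * 2 ^+ n / l `^ p)%:E * ((enorm (e_ v) ^- n.+1)%:E * gradient_Lp_pow p u))%E.
Proof.
move=> l0; set E := [set z | _].
have e0 := enorm_dir_gt0 n v.
have ev0 : e_ v != 0 by rewrite -enorm_gt0.
have mE : measurable E.
  apply: measurable_diff_quotient_superlevel => //.
  by apply: continuous_measurable_rV; exact: smooth_continuous.
have mF : measurable_fun setT (fun z => (\1_E z)%:E : \bar R).
  by apply/measurable_EFinP; exact: measurable_indic.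
have F0 z : (0 <= (\1_E z)%:E :> \bar R)%E by rewrite lee_fin.
have mx : measurable_fun setT (fun x : 'rV[R]_n.+1 => (x, v)) by exact/measurable_fun_pair.
have mf := measurableT_comp (measurable_integral_polar _ _ mF F0) mx.
have f0 (x : 'rV[R]_n.+1) :
    (0 <= \int[mu]_t ((`|t| ^+ n)%:E * (\1_E (x, x + t *: e_ v))%:E))%E.
  by apply: integral_ge0 => t _; rewrite mule_ge0// lee_fin exprn_ge0.
have mg := measurable_gradient_powR u su p.
have g0 (x : 'rV[R]_n.+1) : (0 <= (enorm (gradient u x) `^ p)%:E)%E.
  by rewrite lee_fin powR_ge0.
rewrite (integral_rV_shear _ v)//.
rewrite /gradient_Lp_pow (integral_rV_shear _ v)//.
rewrite muleA -EFinM -ge0_integralZl//; last 3 first.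
- exact: (measurable_integral_shear v _ mg g0).
- by move=> z _; exact: integral_ge0.
- by rewrite lee_fin mulr_ge0 ?divr_ge0 ?powR_ge0 ?mulr_ge0 ?invr_ge0 ?exprn_ge0 ?enorm_ge0.
apply: ge0_le_integral => //.
- by move=> z _; exact: integral_ge0.
- exact: (measurable_integral_shear v _ mf f0).
- by apply: measurable_funeM; exact: (measurable_integral_shear v _ mg g0).
move=> z _; set w := rV_cons (0, z).
set q : R := n.+1%:R / p + 1.
pose lam := l * enorm (e_ v) `^ q.
have lam0 : 0 < lam by rewrite mulr_gt0// powR_gt0.
have cons_pos : 0 <= 20 * 2 ^+ n / lam `^ p.
  by rewrite divr_ge0 ?powR_ge0// mulr_ge0 ?exprn_ge0.
have dg (s : R) := is_derive_C1_line u (smooth_derivable u su)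
  (smooth_partial_continuous u su) w (e_ v) s.
have := line_estimate n p lam _ _ p1 lam0 dg (continuous_directional w (e_ v)).
set V := line_level _ _ _ => le1.
apply: (@le_trans _ _ (\int[mu]_s \int[mu]_t (`|t| ^+ n * \1_V (s, t))%:E)%E).
  rewrite le_eqVlt; apply/orP; left; apply/eqP.
  apply: eq_integral => s _; apply: eq_integral => t _.
  rewrite -EFinM; congr ((_ * _)%:E).
  rewrite !indicE; congr ((nat_of_bool _)%:R).
  have [h1 h2] := superlevel_line l w (e_ v) s t l0 ev0.
  by apply/idP/idP => /set_mem h; apply/mem_set; [exact: h1|exact: h2].
apply: (le_trans le1).
have mdir : measurable_fun setT (fun s : measurableTypeR R =>
    (enorm (gradient u (w + s *: e_ v)) `^ p)%:E).
  have mz : measurable_fun setT (fun s : measurableTypeR R => (z, s)).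
    exact/measurable_fun_pair.
  exact: (measurableT_comp (measurable_shear v _ mg) mz).
apply: (@le_trans _ _ ((20 * 2 ^+ n / lam `^ p)%:E *
    \int[mu]_s ((enorm (e_ v) `^ p)%:E * (enorm (gradient u (w + s *: e_ v)) `^ p)%:E))%E).
  rewrite lee_wpmul2l//.
  apply: ge0_le_integral => //.
  - apply/measurable_EFinP; apply: (measurableT_comp (measurable_powR p)).
    apply: (measurableT_comp (@normr_measurable R setT)).
    by apply: continuous_measurable_fun; exact: continuous_directional.
  - by apply: measurable_funeM.
  move=> s _; rewrite -EFinM lee_fin -powRM ?enorm_ge0//.
  apply: ge0_ler_powR; rewrite ?nnegrE ?(ltW p0) ?mulr_ge0 ?enorm_ge0//.
  rewrite (_ : \sum_(i < n.+1) _ =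
      \sum_(i < n.+1) (e_ v) ord0 i * gradient u (w + s *: e_ v) ord0 i).
    exact: dot_le_enorm.
  by apply: eq_bigr => i _; rewrite [gradient _ _ _ _]mxE.
rewrite ge0_integralZl//; last by rewrite lee_fin powR_ge0.
rewrite muleA -EFinM lee_wpmul2r//; first by apply: integral_ge0.
rewrite lee_fin le_eqVlt; apply/orP; left; apply/eqP.
(* With [N = n + 1], [lam^p] is [l^p] times the [(N + p)]-th power of the length of the direction;
   Cauchy-Schwarz gave back the [p]-th power, which leaves the exponent [-N]. *)
rewrite /lam powRM ?powR_ge0 ?(ltW l0)// -powRrM.
have -> : q * p = n.+1%:R + p by rewrite /q mulrDl mul1r divfK// gt_eqF.
rewrite powRD ?(gt_eqF e0) ?implybT// powR_mulrn ?enorm_ge0//.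
field.
by rewrite !gt_eqF ?powR_gt0 ?exprn_gt0.
Qed.

Lemma superlevel_measure_le (l : R) : 0 < l ->
  ((l `^ p)%:E * (L \x L) [set z | l <= `|diff_quotient p u z|]%R
   <= (20 * 2 ^+ n * 6 ^+ n.+1)%:E * gradient_Lp_pow p u)%E.
Proof.
move=> l0; set E := [set z | _].
have mE : measurable E.
  apply: measurable_diff_quotient_superlevel => //.
  by apply: continuous_measurable_rV; exact: smooth_continuous.
have mF : measurable_fun setT (fun z => (\1_E z)%:E : \bar R).
  by apply/measurable_EFinP; exact: measurable_indic.
have F0 z : (0 <= (\1_E z)%:E :> \bar R)%E by rewrite lee_fin.
rewrite product_measure_integral// [X in (_ * X)%E](integral_rV_polar _ _ mF F0).
have G0 : (0 <= gradient_Lp_pow p u)%E.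
  by apply: integral_ge0 => x _; rewrite lee_fin powR_ge0.
have A0 : 0 <= 20 * 2 ^+ n / l `^ p by rewrite divr_ge0 ?powR_ge0// mulr_ge0 ?exprn_ge0.
have lp0 : 0 < l `^ p by exact: powR_gt0.
have md := @measurable_dir R n.
have d0 (v : 'rV[R]_n) : (0 <= (enorm (e_ v) ^- n.+1)%:E)%E.
  by rewrite lee_fin invr_ge0 exprn_ge0// enorm_ge0.
have H : (\int[lebesgue_rV n]_v \int[L]_x \int[mu]_t ((`|t| ^+ n)%:E *
     (\1_E (x, x + t *: e_ v))%:E) <=
     (20 * 2 ^+ n / l `^ p)%:E * ((6 ^+ n.+1)%:E * gradient_Lp_pow p u))%E.
  apply: (@le_trans _ _ (\int[lebesgue_rV n]_v ((20 * 2 ^+ n / l `^ p)%:E *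
      ((enorm (e_ v) ^- n.+1)%:E * gradient_Lp_pow p u)))%E).
    apply: ge0_le_integral => //.
    - move=> v _; apply: integral_ge0 => x _; apply: integral_ge0 => t _.
      by rewrite mule_ge0// lee_fin exprn_ge0.
    - apply: (measurable_fun_fubini_tonelli_G (m1 := L) _
        (measurable_integral_polar _ _ mF F0)) => z.
      by apply: integral_ge0 => t _; rewrite mule_ge0// lee_fin exprn_ge0.
    - by apply: measurable_funeM; apply: emeasurable_funM.
    by move=> v _; exact: superlevel_dir_le.
  rewrite ge0_integralZl//; last 2 first.
  - exact: emeasurable_funM.
  - by move=> v _; rewrite mule_ge0.
  rewrite lee_wpmul2l// ge0_integralZr// lee_wpmul2r//.
  exact: integral_dir_le.
apply: (@le_trans _ _ ((l `^ p)%:E * ((20 * 2 ^+ n / l `^ p)%:E *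
    ((6 ^+ n.+1)%:E * gradient_Lp_pow p u)))%E).
  by rewrite lee_wpmul2l// lee_fin powR_ge0.
rewrite !muleA -!EFinM lee_wpmul2r// lee_fin le_eqVlt; apply/orP; left; apply/eqP.
by rewrite [l `^ p * _]mulrC divfK ?gt_eqF.
Qed.

End upper_bound.

(** * The lower bound *)

Section limn_einf_bounds.
Context {R : realType}.
Local Open Scope ereal_scope.
Implicit Types (u : (\bar R)^nat) (a : \bar R).

Lemma limn_einfE u : limn_einf u = ereal_sup (range (einfs u)).
Proof. by rewrite limn_einf_lim; apply/cvg_lim => //; exact: cvg_einfs_sup. Qed.

Lemma le_limn_einf u a m : (forall k, (m <= k)%N -> a <= u k) -> a <= limn_einf u.
Proof.
move=> au; rewrite limn_einfE; apply: (@le_trans _ _ (einfs u m)).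
  by apply: le_ereal_inf_tmp => _ [k /= mk <-]; exact: au.
by apply: ereal_sup_ubound; exists m.
Qed.

Lemma limn_einf_le u a : (forall k, u k <= a) -> limn_einf u <= a.
Proof.
move=> ua; rewrite limn_einfE; apply: ge_ereal_sup => _ [m _ <-].
by apply: le_trans (ua m); apply: ereal_inf_lbound; exists m => /=.
Qed.

End limn_einf_bounds.

(** * Cubes inside the slices, and Fatou's lemma *)

Section lower_bound.
Context {R : realType} {n : nat}.
Local Notation L := (@lebesgue_rV R n.+1).
Local Notation N := (n.+1%:R : R).
Variables (u : 'rV[R]_n.+1 -> R) (p : R).
Hypotheses (su : smooth u) (p1 : 1 <= p).

Let p0 : 0 < p. Proof. exact: lt_le_trans p1. Qed.

(* The superlevel slice over x contains the cube of side a / N centered at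
   x + a g / |g|, where g is the gradient of u at x. *)
Lemma superlevel_slice_ge (x : 'rV[R]_n.+1) : exists2 l0 : R, 0 < l0 & forall l, l0 <= l ->
  ((((3 * N) ^- n.+1 / 6) `^ p * enorm (gradient u x) `^ p)%:E <=
    (l `^ p)%:E * L (xsection [set z | (l <= `|diff_quotient p u z|)%R] x))%E.
Proof.
set g := gradient u x.
have gE i : g ord0 i = partial i u x by rewrite mxE.
clearbody g; set G := enorm g.
have [g0|g0] := eqVneq g 0.
  exists 1 => // l _; rewrite /G g0 (_ : enorm 0 = 0); last by apply/eqP; rewrite enorm_eq0.
  by rewrite powR0 ?gt_eqF// mulr0 mule_ge0// lee_fin powR_ge0.
have G0 : 0 < G by rewrite enorm_gt0.
(* The cube lies within [3a/2] of [x], so accuracy [G / 6] costs at most [a G / 4], half of the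
   linear gain [a G / 2]. *)
have e0 : 0 < G / 6 by rewrite divr_gt0.
have [d d0 D] := C1_differentiable u (smooth_derivable u su)
  (smooth_partial_continuous u su) x _ e0.
pose r : R := p / N.
have r0 : 0 < r by rewrite divr_gt0.
have d2 : 0 < (2 * d) `^ r^-1 by rewrite powR_gt0// mulr_gt0.
(* Beyond this threshold [b^r < 2 d], so the radius [3a/2 = b^r / 2] is below [d] and the
   differentiability estimate applies on the cube. *)
exists (G / 6 / (2 * d) `^ r^-1 + 1).
  by rewrite ltr_wpDl// divr_ge0 ?powR_ge0// ltW.
move=> l ll.
have l0 : 0 < l by rewrite (lt_le_trans _ ll)// ltr_wpDl// divr_ge0 ?powR_ge0// ltW.
pose b := G / 6 / l.
have b0 : 0 < b by rewrite divr_gt0.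
have bd : b `^ r < 2 * d.
  have -> : 2 * d = ((2 * d) `^ r^-1) `^ r.
    by rewrite -powRrM mulVf ?gt_eqF// powRr1// mulr_ge0// ltW.
  rewrite gt0_ltr_powR// ?nnegrE ?(ltW b0) ?powR_ge0//.
  rewrite /b ltr_pdivrMr// -ltr_pdivrMl// [ltLHS]mulrC (lt_le_trans _ ll)//.
  by rewrite ltrDl.
pose a := b `^ r / 3.
have a0 : 0 < a by rewrite divr_gt0// powR_gt0.
have arN : (3 * a / 2) `^ (N / p) <= b.
  have bE : b = (b `^ r) `^ (N / p).
    by rewrite -powRrM /r mulrACA [p * N]mulrC -mulrACA divff ?mul1r ?divff ?gt_eqF// powRr1// ltW.
  rewrite [leRHS]bE; apply: ge0_ler_powR; rewrite ?nnegrE ?powR_ge0//.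
  - by rewrite divr_ge0// ltW.
  - by rewrite divr_ge0// mulr_ge0// ltW.
  rewrite /a mulrCA divff// mulr1 ler_pdivrMr//.
  by rewrite ler_peMr ?powR_ge0// ler1n.
(* A half-side [a / (2N)] keeps every point of the cube within Euclidean distance [a / 2] of its
   center, by the bound [enorm_le_coord]. *)
pose A (i : 'I_n.+1) : set R :=
  `[x ord0 i + a / G * g ord0 i - a / (2 * N), x ord0 i + a / G * g ord0 i + a / (2 * N)]%classic.
have mA i : measurable (A i) by exact: measurable_itv.
have sub : [set y : 'rV[R]_n.+1 | forall i, A i (y ord0 i)] `<=`
    xsection [set z | (l <= `|diff_quotient p u z|)%R] x.
  move=> y yA; rewrite /xsection /=; apply/mem_set.
  rewrite diff_quotient_superlevelE//=.
  pose h := y - x.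
  have hE : y = x + h by rewrite /h addrC subrK.
  have hg : enorm (h - (a / G) *: g) <= a / 2.
    rewrite (@le_trans _ _ (N * (a / (2 * N))))//; last first.
      by rewrite le_eqVlt; apply/orP; left; apply/eqP; field; rewrite gt_eqF.
    apply: enorm_le_coord; first by rewrite divr_ge0 ?(ltW a0)// mulr_ge0.
    move=> i; have := yA i; rewrite /A/= in_itv/= !mxE => /andP[y1 y2].
    by rewrite -addrA -opprD ler_distl y1 y2.
  have hn : enorm h <= 3 * a / 2.
    rewrite -[h](subrK ((a / G) *: g)) (le_trans (enormD _ _))//.
    have aG : 0 < a / G by exact: divr_gt0.
    rewrite enormZ (gtr0_norm aG) -/G divfK ?gt_eqF//.
    by move: hg; lra.
  have hcoord i : (h - (a / G) *: g) ord0 i = h ord0 i - a / G * g ord0 i.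
    by rewrite mxE; congr (_ + _); rewrite mxE; congr (- _); rewrite mxE.
  have gh : a * G / 2 <= \sum_(i < n.+1) h ord0 i * g ord0 i.
    have -> : \sum_(i < n.+1) h ord0 i * g ord0 i =
        a * G + \sum_(i < n.+1) (h - (a / G) *: g) ord0 i * g ord0 i.
      under [in RHS]eq_bigr => i _ do rewrite hcoord mulrBl.
      rewrite sumrB.
      have -> : \sum_(i < n.+1) a / G * g ord0 i * g ord0 i = a * G.
        under eq_bigr => i _ do rewrite -mulrA -expr2.
        by rewrite -mulr_sumr -enorm_sqr -/G; field; rewrite gt_eqF.
      by rewrite addrC subrK.
    have := dot_le_enorm (h - (a / G) *: g) g; rewrite -/G ler_norml => /andP[+ _].
    have : enorm (h - (a / G) *: g) * G <= a / 2 * G by rewrite ler_wpM2r// ltW.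
    lra.
  have hd : `|h| < d.
    rewrite (le_lt_trans (norm_le_enorm _))// (le_lt_trans hn)//.
    by rewrite /a mulrCA divff// mulr1 ltr_pdivrMr// mulrC.
  have ah : a * G / 4 <= `|u x - u y|.
    have := D h hd; rewrite -hE => Dh.
    have : \sum_(i < n.+1) h ord0 i * partial i u x = \sum_(i < n.+1) h ord0 i * g ord0 i.
      by apply: eq_bigr => i _; rewrite gE.
    move=> E; rewrite E in Dh; rewrite distrC.
    have h3 : G / 6 * `|h| <= G / 6 * (3 * a / 2).
      by rewrite ler_wpM2l ?(ltW e0)// (le_trans (norm_le_enorm _)).
    rewrite (le_trans _ (ler_norm _))//.
    move: Dh; rewrite ler_norml => /andP[+ _]; move: h3 gh; lra.
  have exy : enorm (x - y) = enorm h by rewrite -enormN opprB.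
  have eh : enorm h != 0.
    rewrite enorm_eq0; apply/eqP => h0; move: gh; rewrite h0 big1; last first.
      by move=> i _; rewrite mxE mul0r.
    by rewrite leNgt divr_gt0// mulr_gt0.
  rewrite exy; split => //; apply: le_trans ah.
  have en0 := enorm_ge0 h.
  rewrite powRD ?(negbTE eh) ?eh ?implybT// powRr1// mulrA.
  (* The values of [a] and [b] were chosen so that [(3a/2)^(N/p) <= b] and
     [l b (3a/2) = a G / 4]. *)
  apply: (@le_trans _ _ (l * b * (3 * a / 2))).
    apply: ler_pM => //; first by rewrite mulr_ge0 ?powR_ge0 ?(ltW l0).
    rewrite ler_pM2l// (le_trans _ arN)//.
    by apply: ge0_ler_powR; rewrite ?nnegrE// ?(le_trans en0 hn)// divr_ge0// ltW.
  rewrite /b le_eqVlt; apply/orP; left; apply/eqP; field; exact: lt0r_neq0.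
apply: (@le_trans _ _ ((l `^ p)%:E * ((a / N) ^+ n.+1)%:E)%E); last first.
  rewrite lee_wpmul2l ?lee_fin ?powR_ge0//.
  rewrite (_ : ((a / N) ^+ n.+1)%:E = L [set y : 'rV[R]_n.+1 | forall i, A i (y ord0 i)]).
    apply: le_measure => //; rewrite inE.
      exact: measurable_rV_box.
    apply: measurable_xsection; apply: measurable_diff_quotient_superlevel => //.
    by apply: continuous_measurable_rV; exact: smooth_continuous.
  rewrite lebesgue_rV_box//.
  have muA i : lebesgue_measure (A i) = (a / N)%:E.
    rewrite lebesgue_measure_itv/= lte_fin ifT.
      by rewrite -EFinD; congr EFin; field; rewrite nat1r !gt_eqF.
    have t0 : 0 < a / (2 * N) by rewrite divr_gt0// mulr_gt0.
    by rewrite ltrD2l (lt_trans _ t0)// oppr_lt0.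
  under eq_bigr do rewrite muA.
  by rewrite prodEFin prodr_const card_ord.
rewrite -EFinM lee_fin.
have NN0 : 0 < (3 * N) ^- n.+1 by rewrite invr_gt0 exprn_gt0// mulr_gt0.
have NN1 : (3 * N) ^- n.+1 <= 1.
  by rewrite invf_le1 ?exprn_gt0 ?mulr_gt0// exprn_ege1// -natrM ler1n.
have -> : l `^ p * (a / N) ^+ n.+1 = (3 * N) ^- n.+1 * 6^-1 `^ p * G `^ p.
  have aN : a ^+ n.+1 = b `^ p / 3 ^+ n.+1.
    rewrite /a expr_div_n; congr (_ / _).
    by rewrite -powR_mulrn ?powR_ge0// -powRrM /r divfK// gt_eqF.
  have bp : l `^ p * b `^ p = G `^ p * 6^-1 `^ p.
    rewrite -!powRM ?ltW// ?invr_gt0//; congr (_ `^ _).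
    by rewrite /b mulrC divfK// gt_eqF.
  rewrite expr_div_n aN exprMn invfM.
  transitivity (l `^ p * b `^ p * (3 ^- n.+1 / N ^+ n.+1)); first by ring.
  by rewrite bp; ring.
(* The volume factor [(3N)^(-N)] is at most 1, hence at least its own [p]-th power; this puts the
   constant in the form [c^p] with [c] free of [p]. *)
rewrite ler_wpM2r ?powR_ge0// powRM ?invr_ge0 ?(ltW NN0)// ler_wpM2r ?powR_ge0//.
by rewrite ge1r_powR// NN0.
Qed.

(** Fatou's lemma along the integer levels [m + 1]: each slice integral is a member of the family
    whose supremum defines the quasi-norm. *)
Lemma gradient_le_marcinkiewicz :
  ((((3 * N) ^- n.+1 / 6) `^ p)%:E * gradient_Lp_pow p u <=
   marcinkiewicz_pow (L \x L) p (diff_quotient p u))%E.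
Proof.
pose E (l : R) := [set z | (l <= `|diff_quotient p u z|)%R].
have mE l : 0 < l -> measurable (E l).
  move=> l0; apply: measurable_diff_quotient_superlevel => //.
  by apply: continuous_measurable_rV; exact: smooth_continuous.
pose f (m : nat) (x : 'rV[R]_n.+1) : \bar R :=
  ((m.+1%:R `^ p)%:E * L (xsection (E m.+1%:R) x))%E.
have mx m : measurable_fun setT (fun x => L (xsection (E m.+1%:R) x)).
  exact: (measurable_fun_xsection L (mE _ _)).
have mf m : measurable_fun setT (f m) by exact: measurable_funeM.
have f0 m x : (0 <= f m x)%E by rewrite mule_ge0// lee_fin powR_ge0.
rewrite /gradient_Lp_pow -ge0_integralZl//; last 2 first.
- exact: (measurable_gradient_powR u su p).
- by move=> x _; rewrite lee_fin powR_ge0.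
apply: (@le_trans _ _ (\int[L]_x limn_einf (f ^~ x))%E).
  apply: ge0_le_integral => //.
  - by move=> x _; rewrite -EFinM lee_fin mulr_ge0 ?powR_ge0.
  - by apply: measurable_funeM; exact: (measurable_gradient_powR u su p).
  (* The lower limit is the opposite of the upper limit of the opposites, so measurability is
     inherited from [limn_esup]. *)
  - have mNf m : measurable_fun setT (fun x => - f m x)%E.
      exact: (measurableT_comp (@oppe_measurable R setT) (mf m)).
    exact: (measurableT_comp (@oppe_measurable R setT) (measurable_fun_limn_esup mNf)).
  move=> x _; have [l0 l0_gt0 sl] := superlevel_slice_ge x.
  apply: (le_limn_einf _ _ (Num.truncn l0)) => k lk.
  rewrite -EFinM /f; apply: sl.
  by rewrite (le_trans (ltW (truncnS_gt _)))// ler_nat.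
apply: le_trans (fatou L measurableT mf (fun m x _ => f0 m x)) _.
apply: limn_einf_le => m; rewrite /f ge0_integralZl//.
by apply: ereal_sup_ubound; exists m.+1%:R => /=.
Qed.

End lower_bound.

Theorem theorem1p1 (R : realType) (N : nat) (hN : (1 <= N)%N) :
  exists c C : R, 0 < c /\
    forall u : 'rV[R]_N -> R, smooth u -> compactly_supported u ->
    forall p : R, 1 <= p ->
      ((c `^ p)%:E * gradient_Lp_pow p u
         <= marcinkiewicz_pow (lebesgue_rV N \x lebesgue_rV N) p
              (diff_quotient p u))%E /\
      (marcinkiewicz_pow (lebesgue_rV N \x lebesgue_rV N) p
         (diff_quotient p u)
         <= C%:E * gradient_Lp_pow p u)%E.
Proof.
case: N hN => // n _.
(* In the upper constant, [20 * 2^n] comes from the covering on lines and [6^(n+1)] from the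
   integral over directions. *)
exists ((3 * n.+1%:R) ^- n.+1 / 6), (20 * 2 ^+ n * 6 ^+ n.+1); split.
  by rewrite divr_gt0// invr_gt0 exprn_gt0// mulr_gt0.
move=> u su _ p p1; split; first exact: gradient_le_marcinkiewicz.
by apply: ge_ereal_sup => _ [l /= l0 <-]; exact: superlevel_measure_le.
Qed.
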